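(* Let $q=p^r$ be a prime power, $m\geq 1$, let $V=\mathbb{F}_q^{2m}$ be the defining representation of $\mathrm{Sp}_{2m}(\mathbb{F}_q)$ with the dual basis $y_1,\ldots,y_m,x_m,\ldots,x_1$ specified in the context, and let $USp_{2m}$ be the group of upper-triangular unipotent matrices in $\mathrm{Sp}_{2m}(\mathbb{F}_q)$. The ring of invariants $\mathbb{F}_q[V]^{USp_{2m}}$ is the complete intersection generated by $\xi_1,\ldots,\xi_{2m-2}$, $N(x_1),\ldots,N(x_m)$ and $N_m(y_m),N_{m-1}(y_{m-1}),\ldots,N_1(y_1)$.
   Context: Choose an ordered basis $e_1,\ldots,e_m,f_m,\ldots,f_1$ of $V$ with dual basis $y_1,\ldots,y_m,x_m,\ldots,x_1$, such that the symplectic form is represented by $J=\begin{pmatrix}0&Q\\-Q&0\end{pmatrix}$, where $Q$ is the $m\times m$ matrix with $1$'s on the antidiagonal and $0$ elsewhere. $\mathrm{Sp}_{2m}(\mathbb{F}_q)$ is the group of $A\in\mathrm{GL}_{2m}(\mathbb{F}_q)$ with $A^TJA=J$, acting on column vectors. A subgroup $H\leq\mathrm{GL}(V)$ acts on the right on $V^*$ by $(\phi\cdot g)(v)=\phi(gv)$ and on the symmetric algebra $\mathbb{F}_q[V]=\mathbb{F}_q[y_1,\ldots,y_m,x_m,\ldots,x_1]$ of $V^*$ by algebra automorphisms; $\mathbb{F}_q[V]^H$ is the ring of invariants. Notation: $\xi_i:=\sum_{j=1}^m\left(y_j^{q^i}x_j-y_jx_j^{q^i}\right)$. $N(x_i):=\prod_v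 (x_i+v)$, with $v$ running over the $\mathbb{F}_q$-span of $x_1,\ldots,x_{i-1}$ (so $N(x_1)=x_1$). For $1\leq k\leq m$, $N_k(t):=\prod_{v\in W_k}(t+v)$, where $W_k$ is the $\mathbb{F}_q$-span of $\{x_1,\ldots,x_m,y_m,\ldots,y_{k+1}\}$. A finitely generated graded $\mathbb{F}_q$-algebra $B$ with minimal homogeneous generators $f_1,\ldots,f_s$ is a complete intersection if the kernel of $\mathbb{F}_q[X_1,\ldots,X_s]\to B$, $X_i\mapsto f_i$, is generated by a regular sequence. *)

(* Defs.v *)
From mathcomp Require Import all_boot all_order all_algebra.
From mathcomp.multinomials Require Import mpoly.

Set Implicit Arguments.
Unset Strict Implicit.
Unset Printing Implicit Defensive.

Import GRing.Theory.
Local Open Scope ring_scope.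

Section CompleteIntersection.

Definition in_ideal (R : comNzRingType) (r : seq R) (a : R) : Prop :=
  exists c : 'I_(size r) -> R, a = \sum_(i < size r) c i * r`_i.

Definition regular_sequence (R : comNzRingType) (r : seq R) : Prop :=
  (forall i, (i < size r)%N ->
     forall a : R, in_ideal (take i r) (a * r`_i) -> in_ideal (take i r) a)
  /\ ~ in_ideal r 1.

Variables (K : fieldType) (n : nat).
Implicit Type B : {mpoly K[n]} -> Prop.

Definition generates B (s : nat) (f : s.-tuple {mpoly K[n]}) : Prop :=
  forall b, B b <-> exists P : {mpoly K[s]}, P \mPo f = b.

Definition minimal_homogeneous_generators B (s : nat)
    (f : s.-tuple {mpoly K[n]}) : Prop :=
  [/\ forall i, exists d : nat, tnth f i \is d.-homog,
      generates B f &
      forall (t : nat) (g : t.-tuple {mpoly K[n]}),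
        subseq g f -> (t < s)%N -> ~ generates B g].

Definition complete_intersection_generated_by B (s : nat)
    (f : s.-tuple {mpoly K[n]}) : Prop :=
  minimal_homogeneous_generators B f /\
  exists r : seq {mpoly K[s]},
    regular_sequence r /\
    (forall P : {mpoly K[s]}, P \mPo f = 0 <-> in_ideal r P).

End CompleteIntersection.

Section Action.

Variables (K : fieldType) (n : nat).

(* V is the space of column vectors and V^* the space of row vectors, with
   phi(v) = phi *m v; hence (phi . g)(v) = phi(g v) reads phi . g = phi *m g.
   The i-th dual basis vector is the variable 'X_i of K[V]. *)
Definition linform (phi : 'rV[K]_n) : {mpoly K[n]} :=
  \sum_(i < n) phi 0 i *: 'X_i.

Definition mpoly_act (p : {mpoly K[n]}) (g : 'M[K]_n) : {mpoly K[n]} :=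
  p \mPo [tuple linform (delta_mx 0 i *m g) | i < n].

Definition invariant_ring (H : 'M[K]_n -> Prop) (p : {mpoly K[n]}) : Prop :=
  forall g, H g -> mpoly_act p g = p.

Definition upper_triangular (A : 'M[K]_n) : Prop :=
  forall i j : 'I_n, (j < i)%N -> A i j = 0.

Definition unipotent (A : 'M[K]_n) : Prop :=
  exists k : nat, (A - 1%:M) ^+ k = 0.

End Action.

Section Symplectic.

Variables (F : finFieldType) (m : nat).

Definition antidiag : 'M[F]_m := \matrix_(i, j) (j == rev_ord i)%:R.

Definition sympJ : 'M[F]_(m + m) := block_mx 0 antidiag (- antidiag) 0.

Definition Sp (A : 'M[F]_(m + m)) : Prop :=
  A \in unitmx /\ A^T *m sympJ *m A = sympJ.

Definition USp (A : 'M[F]_(m + m)) : Prop :=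
  [/\ Sp A, upper_triangular A & unipotent A].

(* Indices start at 0: [ydual j] and [xdual j] are y_(j+1) and x_(j+1) in the
   ordered dual basis y_1, ..., y_m, x_m, ..., x_1. *)
Definition ydual (j : 'I_m) : 'rV[F]_(m + m) := delta_mx 0 (lshift m j).
Definition xdual (j : 'I_m) : 'rV[F]_(m + m) := delta_mx 0 (rshift m (rev_ord j)).

Definition y (j : 'I_m) : {mpoly F[m + m]} := linform (ydual j).
Definition x (j : 'I_m) : {mpoly F[m + m]} := linform (xdual j).

Definition xi (i : nat) : {mpoly F[m + m]} :=
  \sum_(j < m) (y j ^+ (#|F| ^ i) * x j - y j * x j ^+ (#|F| ^ i)).

Definition Nx (i : 'I_m) : {mpoly F[m + m]} :=
  \prod_(v : 'rV[F]_(m + m) | (v <= \sum_(j < m | (j < i)%N) <<xdual j>>)%MS)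
    (x i + linform v).

Definition Wspan (k : 'I_m) : 'M[F]_(m + m) :=
  (\sum_(j < m) <<xdual j>> + \sum_(j < m | (k < j)%N) <<ydual j>>)%MS.

Definition Ny (k : 'I_m) (t : {mpoly F[m + m]}) : {mpoly F[m + m]} :=
  \prod_(v : 'rV[F]_(m + m) | (v <= Wspan k)%MS) (t + linform v).

Definition USp_generators : (2 * m - 2 + (m + m)).-tuple {mpoly F[m + m]} :=
  [tuple of [tuple xi i.+1 | i < 2 * m - 2] ++
    ([tuple Nx i | i < m] ++
     [tuple Ny (rev_ord k) (y (rev_ord k)) | k < m])].

End Symplectic.

(* Main.v *)
(** Order the coordinates as u_0, ..., u_(2m-1) = x_1, ..., x_m, y_m, ..., y_1 and
    put E_0(t) = t, E_(a+1)(t) = E_a(t)^q - E_a(u_a)^(q-1) E_a(t), the product of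
    t + v over v in the span of u_0, ..., u_(a-1). All the N(x_i) and N_k(y_k) are
    values N_a = E_a(u_a), and E_a(t) = sum_l c_(a,l) t^(q^l) with c_(a,l) a polynomial
    in the N_b, b < a. Since xi_(l-i)^(q^i) is the value of the symplectic form on the
    Frobenius twists l and i of the generic point, expanding
    sum_j (E_a(y_j) E_b(x_j) - E_b(y_j) E_a(x_j)), which is 0 for a + b = 2m and
    N_a N_b for a + b = 2m - 1, gives a relation with leading term xi_(a-b)^(q^b).

    Regularity: the linear map sending X^mu to
    prod_i X_i^(mu_i mod d_i) R_i^(mu_i div d_i) is unitriangular for a suitable
    weight and turns multiplication by X_i^(d_i) into multiplication by R_i; so the
    R_i behave like pure powers of distinct variables.

    Both the absence of further relations and the generation of all invariants are
    proved by removing one hyperbolic pair (x_1, y_1) at a time. Modulo x_1 the xi_i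
    become those of rank m - 1 and the other N_a become q-th powers; the xi_i of rank
    m - 1 are p-independent because their Jacobian is a Moore determinant, which
    reduces a relation to its coefficients, that is, to rank m - 1. After
    inverting x_1, the invariants of the unipotent radical fixing x_1 are polynomials
    in xi_1 and in E_1 of the middle coordinates, on which the group of rank m - 1
    acts as on its natural module; denominators are then removed because an element
    of the algebra divisible by x_1 is x_1 times an element of the algebra. *)
From HB Require Import structures.
Require Import Defs.
From mathcomp Require Import all_boot all_order all_algebra all_field.
From mathcomp.multinomials Require Import mpoly.
From mathcomp Require Import ring zify.

Set Implicit Arguments.
Unset Strict Implicit.
Unset Printing Implicit Defensive.

Import GRing.Theory.
Local Open Scope ring_scope.

(** * Substitution in polynomial rings *)

Section Substitution.
Variable K : fieldType.

Lemma mpoly_morph_ext (n : nat) (A : comNzRingType)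
    (f g : {rmorphism {mpoly K[n]} -> A}) :
  (forall c, f c%:MP = g c%:MP) -> (forall i, f 'X_i = g 'X_i) -> f =1 g.
Proof.
move=> fgC fgX p; rewrite [p]mpolyE !rmorph_sum; apply: eq_bigr => mu _.
rewrite -mul_mpolyC !rmorphM fgC; congr (_ * _).
rewrite mpolyXE_id !rmorph_prod; apply: eq_bigr => i _.
by rewrite !rmorphXn fgX.
Qed.

Definition subst (k n : nat) (g : 'I_k -> {mpoly K[n]}) (P : {mpoly K[k]}) :=
  P \mPo [tuple g i | i < k].

Fact subst_is_linear k n (g : 'I_k -> {mpoly K[n]}) : linear (subst g).
Proof. by move=> c P Q; rewrite /subst linearP. Qed.
Fact subst_is_monoid k n (g : 'I_k -> {mpoly K[n]}) : monoid_morphism (subst g).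
Proof. by split=> [|P Q]; rewrite /subst ?rmorph1 ?rmorphM. Qed.
HB.instance Definition _ k n (g : 'I_k -> {mpoly K[n]}) :=
  GRing.isLinear.Build K _ _ _ (subst g) (subst_is_linear g).
HB.instance Definition _ k n (g : 'I_k -> {mpoly K[n]}) :=
  GRing.isMonoidMorphism.Build _ _ (subst g) (subst_is_monoid g).

Lemma substX k n (g : 'I_k -> {mpoly K[n]}) i : subst g 'X_i = g i.
Proof. by rewrite /subst comp_mpolyXU -tnth_nth tnth_mktuple. Qed.

Lemma substC k n (g : 'I_k -> {mpoly K[n]}) c : subst g c%:MP = c%:MP.
Proof. exact: comp_mpolyC. Qed.

Lemma subst_comp k n l (g : 'I_k -> {mpoly K[n]}) (h : 'I_n -> {mpoly K[l]}) P :
  subst h (subst g P) = subst (fun i => subst h (g i)) P.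
Proof.
move: P; apply: (@mpoly_morph_ext _ _ (subst h \o subst g)) => [c|i] /=.
  by rewrite !substC.
by rewrite !substX.
Qed.

Lemma eq_subst k n (g h : 'I_k -> {mpoly K[n]}) : g =1 h -> subst g =1 subst h.
Proof.
by move=> gh; apply: mpoly_morph_ext => [c|i] /=; rewrite ?substC // !substX.
Qed.

Lemma subst_id n (P : {mpoly K[n]}) : subst (fun i => 'X_i) P = P.
Proof. exact: comp_mpoly_id. Qed.

Lemma substXm k n (g : 'I_k -> {mpoly K[n]}) mu :
  subst g 'X_[mu] = \prod_i g i ^+ mu i.
Proof.
by rewrite mpolyXE_id rmorph_prod; apply: eq_bigr => i _; rewrite rmorphXn /= substX.
Qed.

Lemma substE k n (g : 'I_k -> {mpoly K[n]}) P :
  subst g P = \sum_(mu <- msupp P) P@_mu *: \prod_i g i ^+ mu i.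
Proof.
rewrite {1}[P]mpolyE raddf_sum /=; apply: eq_bigr => mu _.
by rewrite linearZ /= substXm.
Qed.

Lemma eq_subst_supp k n (g h : 'I_k -> {mpoly K[n]}) P :
  (forall mu i, mu \in msupp P -> mu i != 0 -> g i = h i) ->
  subst g P = subst h P.
Proof.
move=> gh; rewrite !substE big_seq [RHS]big_seq; apply: eq_bigr => mu muP.
congr (_ *: _); apply: eq_bigr => i _.
by have [->|/gh ->] := eqVneq (mu i) 0.
Qed.

Lemma mderiv_const n (i : 'I_n) (f : {mpoly K[n]}) p :
  p \in [pchar K] -> (f ^+ p)^`M(i) = 0.
Proof.
move=> pK; have derivX e : (f ^+ e)^`M(i) = e%:R * (f ^+ e.-1 * f^`M(i)).
  elim: e => [|e IHe]; first by rewrite expr0 -mpolyC1 mderivC mul0r.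
  rewrite exprS mderivM IHe; case: e {IHe} => [|e] /=; first by rewrite expr0; ring.
  by rewrite !exprS -(natr1 e.+1); ring.
by rewrite derivX -mpolyC_nat pcharf0 // mpolyC0 mul0r.
Qed.

Lemma chain_rule k n (g : 'I_k -> {mpoly K[n]}) (b : 'I_n) P :
  (subst g P)^`M(b) = \sum_(i < k) subst g P^`M(i) * (g i)^`M(b).
Proof.
move: P; pose chain P := (subst g P)^`M(b) = \sum_(i < k) subst g P^`M(i) * (g i)^`M(b).
have chainD P Q : chain P -> chain Q -> chain (P + Q).
  rewrite /chain rmorphD mderivD /= => -> ->; rewrite -big_split /=.
  by apply: eq_bigr => i _; rewrite mderivD rmorphD /= mulrDl.
have chainC c : chain c%:MP.
  rewrite /chain substC mderivC big1 // => i _.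
  by rewrite mderivC rmorph0 mul0r.
have chainM P Q : chain P -> chain Q -> chain (P * Q).
  rewrite /chain rmorphM mderivM /= => -> ->.
  rewrite mulr_suml mulr_sumr -big_split /=.
  by apply: eq_bigr => i _; rewrite mderivM rmorphD !rmorphM /=; ring.
have chainX i : chain 'X_i.
  rewrite /chain substX (bigD1 i) //= big1 ?addr0 => [|j ji].
    by rewrite mderivX mnm1E eqxx scale1r -[X in (X - _)%MM]add0m addmK mpolyX0 rmorph1 mul1r /=.
  by rewrite mderivX mnm1E eq_sym (negPf ji) scale0r rmorph0 mul0r.
suff: forall P, chain P by [].
elim/mpolyind => [|c mu P _ _ IH]; first by rewrite -mpolyC0; apply: chainC.
apply: (chainD) IH; rewrite -mul_mpolyC; apply: (chainM) => //.
rewrite mpolyXE_id; elim/big_ind: _ => // [|i _]; first by rewrite -mpolyC1.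
elim: (mu i) => [|e IHe]; first by rewrite expr0 -mpolyC1.
by rewrite exprS; apply: chainM.
Qed.

End Substitution.

(** * Singling out one variable of a polynomial ring *)

Section OneVariable.
Variables (K : fieldType) (n : nat).
Implicit Types (f g : {mpoly K[n]}) (i : 'I_n).

Definition subst1 i g := subst (fun j => if j == i then g else 'X_j).

(** The coefficients stay in the full ring, where they happen to be free of ['X_i], so that no
    smaller polynomial ring has to be introduced. *)
Definition uni i : {mpoly K[n]} -> {poly {mpoly K[n]}} :=
  mmap (polyC \o @mpolyC n K) (fun j => if j == i then 'X else ('X_j)%:P).
HB.instance Definition _ i := GRing.RMorphism.on (uni i).
HB.instance Definition _ i g := GRing.RMorphism.on (subst1 i g).
HB.instance Definition _ i g := GRing.Linear.on (subst1 i g).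

Lemma uniC i c : uni i c%:MP = (c%:MP)%:P.
Proof. by rewrite /uni mmapC. Qed.

Lemma uniX i j : uni i 'X_j = if j == i then 'X else ('X_j)%:P.
Proof. by rewrite /uni mmapX mmap1U. Qed.

Lemma subst1X i g j : subst1 i g 'X_j = if j == i then g else 'X_j.
Proof. by rewrite /subst1 substX. Qed.

Lemma subst1C i g c : subst1 i g c%:MP = c%:MP.
Proof. exact: substC. Qed.

Lemma horner_uni i g f : (uni i f).[g] = subst1 i g f.
Proof.
move: f; apply: (@mpoly_morph_ext _ _ _ (horner_eval g \o uni i)) => [c|j] /=.
  by rewrite uniC subst1C /horner_eval hornerC.
by rewrite uniX subst1X /horner_eval; case: ifP; rewrite ?hornerX ?hornerC.
Qed.

Lemma uni_subst1 i g f : uni i (subst1 i g f) = uni i f \Po uni i g.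
Proof.
move: f; apply: (@mpoly_morph_ext _ _ _ (uni i \o subst1 i g)
  (comp_poly (uni i g) \o uni i)) => [c|j] /=.
  by rewrite subst1C !uniC comp_polyC.
rewrite subst1X !uniX; case: eqP => ji; first by rewrite comp_polyX.
by rewrite uniX comp_polyC; case: eqP.
Qed.

Lemma subst1_id i f : subst1 i 'X_i f = f.
Proof.
rewrite -[RHS]subst_id; apply: eq_subst => j.
by case: eqP => // ->.
Qed.

Lemma uni_inj i : injective (uni i).
Proof. by move=> f g fg; rewrite -(subst1_id i f) -horner_uni fg horner_uni subst1_id. Qed.

(** Through [uni] the substitution becomes composition with a polynomial of positive degree over a
    domain. *)
Lemma subst1_inj i g : (1 < size (uni i g))%N -> injective (subst1 i g).
Proof.
move=> sz_g; apply: raddf_inj => f f0; apply/eqP.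
have: uni i f \Po uni i g = 0 by rewrite -uni_subst1 f0 rmorph0.
move/eqP; rewrite comp_poly_eq0 //.
by rewrite -(inj_eq (@uni_inj i)) rmorph0.
Qed.

Lemma subst1_factor i g f : exists h, f - subst1 i g f = ('X_i - g) * h.
Proof.
have [h fh] : exists h, uni i f - (subst1 i g f)%:P = h * ('X - g%:P).
  apply/factor_theorem; rewrite /root hornerD hornerN hornerC horner_uni.
  by rewrite subrr.
(* Evaluating the univariate quotient at ['X_i] leads back to the original ring. *)
exists (h.['X_i]); rewrite mulrC -(hornerXsubC g 'X_i) -hornerM -fh.
by rewrite hornerD hornerN hornerC horner_uni subst1_id.
Qed.

(** Independence of ['X_i], encoded as being fixed by the morphism ['X_i := 0]; closure under ring
    operations is then immediate. *)
Definition free_of i f := subst1 i 0 f = f.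

Lemma free_ofE i g f : free_of i f -> subst1 i g f = f.
Proof.
move=> fi; rewrite -{1}fi /subst1 subst_comp -[RHS]fi; apply: eq_subst => j.
case: (eqVneq j i) => [|ji]; first by rewrite rmorph0.
by rewrite substX (negPf ji).
Qed.

Lemma uni_free i f : free_of i f -> uni i f = f%:P.
Proof.
move=> fi; rewrite -fi.
apply: (@mpoly_morph_ext _ _ _ (uni i \o subst1 i 0) (polyC \o subst1 i 0))
   => [c|j] /=; rewrite ?subst1C ?uniC // subst1X.
case: (eqVneq j i) => [|ji]; first by rewrite !rmorph0.
by rewrite uniX (negPf ji).
Qed.

Lemma free_subst1 i g f : free_of i g -> free_of i (subst1 i g f).
Proof.
rewrite /free_of {1 3}/subst1 => gi; rewrite /subst1 subst_comp; apply: eq_subst => j.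
case: (eqVneq j i) => [//|ji]; by rewrite substX (negPf ji).
Qed.

End OneVariable.

(** * Replacing the variables by powers of themselves *)

Section PowerSubstitution.
Variables (K : fieldType) (n : nat).

Definition powsub (e : 'I_n -> nat) : {mpoly K[n]} -> {mpoly K[n]} :=
  subst (fun i => 'X_i ^+ e i).
HB.instance Definition _ e := GRing.RMorphism.on (powsub e).
HB.instance Definition _ e := GRing.Linear.on (powsub e).

Lemma powsubXm e (mu : 'X_{1..n}) :
  powsub e 'X_[mu] = 'X_[[multinom (mu i * e i)%N | i < n]].
Proof.
rewrite /powsub substXm [RHS]mpolyXE_id; apply: eq_bigr => i _.
by rewrite mnmE -exprM mulnC.
Qed.

Lemma powsub_inj e : (forall i, 0 < e i)%N -> injective (powsub e).
Proof.
move=> e_gt0; apply: raddf_inj => f f0; apply/mpolyP => mu; rewrite mcoeff0.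
have: (powsub e f)@_[multinom (mu i * e i)%N | i < n] = 0 by rewrite f0 mcoeff0.
rewrite {1}[f]mpolyE (raddf_sum (powsub e)) (raddf_sum (mcoeff _)) /=.
rewrite (eq_bigr (fun nu => (nu == mu)%:R * f@_nu)) => [|nu _].
  have [muf|muf] := boolP (mu \in msupp f); last by rewrite (memN_msupp_eq0 muf).
  rewrite (bigD1_seq mu) ?msupp_uniq //= eqxx mul1r big1 ?addr0 //.
  by move=> nu /negPf ->; rewrite mul0r.
rewrite linearZ /= powsubXm mcoeffZ mcoeffX.
rewrite mulrC; congr (_%:R * _); congr nat_of_bool; apply/eqP/eqP => [|-> //].
move/mnmP => eq_e; apply/mnmP => i; have := eq_e i; rewrite !mnmE.
by move/eqP; rewrite eqn_pmul2r // => /eqP.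
Qed.

(** The clause on the support transports degree bounds from [f] to its preimage, which the descent
    along powers of p requires. *)
Lemma powsub_preim e f :
  (forall mu i, mu \in msupp f -> e i %| mu i)%N ->
  exists2 g, f = powsub e g & forall nu, nu \in msupp g ->
    [multinom (nu i * e i)%N | i < n] \in msupp f.
Proof.
move=> dvd_e; pose dv (mu : 'X_{1..n}) := [multinom (mu i %/ e i)%N | i < n].
have dvK mu : mu \in msupp f -> [multinom (dv mu i * e i)%N | i < n] = mu.
  by move=> muf; apply/mnmP => i; rewrite !mnmE divnK ?dvd_e.
exists (\sum_(mu <- msupp f) f@_mu *: 'X_[dv mu]).
  rewrite {1}[f]mpolyE (raddf_sum (powsub e)) /= big_seq [RHS]big_seq; apply: eq_bigr => mu muf.
  by rewrite linearZ /= powsubXm dvK.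
move=> nu /msupp_sum_le /flattenP [s /mapP [mu]]; rewrite mem_filter /= => muf ->.
move=> /msuppZ_le; rewrite msuppX inE => /eqP ->.
by rewrite dvK.
Qed.

End PowerSubstitution.

(** * Orbit polynomials of a flag and the symplectic form *)

Section FlagOperators.
Variables (q : nat).

Section Definitions.
Variable A : comNzRingType.
Implicit Types (u N X : nat -> A).

(** This is the operator E_a of the overview; the recursion adds one basis vector at a time and
    avoids enumerating the span. *)
Fixpoint flagop u (a : nat) (t : A) : A :=
  if a is b.+1 then
    flagop u b t ^+ q - flagop u b (u b) ^+ q.-1 * flagop u b t
  else t.

Definition orbprod u a := flagop u a (u a).

(** The coefficients c_(a,l). The orbit products enter as a formal sequence [N], so that the same
    recursion serves for their true values and for the variables that stand for them. *)
Fixpoint flagcoef N (a l : nat) : A :=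
  if a is b.+1 then
    (if l is k.+1 then flagcoef N b k ^+ q else 0) - N b ^+ q.-1 * flagcoef N b l
  else (l == 0)%:R.

(** The symplectic form on the l-th and i-th Frobenius twists of the generic point; the coordinate
    of index j is paired with that of index 2m - 1 - j. *)
Definition bil u m l i : A := \sum_(j < m)
  (u (m.*2.-1 - j)%N ^+ (q ^ l) * u j ^+ (q ^ i)
   - u (m.*2.-1 - j)%N ^+ (q ^ i) * u j ^+ (q ^ l)).

Definition sympform u m i : A := \sum_(j < m)
  (u (m.*2.-1 - j)%N ^+ (q ^ i) * u j - u (m.*2.-1 - j)%N * u j ^+ (q ^ i)).

(** Here [X] stands for the sequence of the xi_i; the sign for l < i reflects that the form is
    alternating. *)
Definition twist X l i : A :=
  if (i <= l)%N then X (l - i)%N ^+ (q ^ i) else - X (i - l)%N ^+ (q ^ l).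

Definition relsum N X a b : A := \sum_(l < a.+1) \sum_(i < b.+1)
  flagcoef N a l * flagcoef N b i * twist X l i.

End Definitions.

Section Theory.
Variable A : comNzRingType.
Hypotheses (qA : [pchar A].-nat q) (q_gt1 : (1 < q)%N).
Implicit Types (u N X : nat -> A).

Lemma pcharX i : [pchar A].-nat (q ^ i)%N.
Proof. by rewrite pnatX qA. Qed.

Lemma expqD i (x y : A) : (x + y) ^+ (q ^ i) = x ^+ (q ^ i) + y ^+ (q ^ i).
Proof. by rewrite exprDn_pchar // pcharX. Qed.

Lemma expqN i (x : A) : (- x) ^+ (q ^ i) = - x ^+ (q ^ i).
Proof.
apply/eqP; rewrite -addr_eq0 -expqD addNr expr0n.
by rewrite expn_eq0; case: q q_gt1.
Qed.

Lemma expqB i (x y : A) : (x - y) ^+ (q ^ i) = x ^+ (q ^ i) - y ^+ (q ^ i).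
Proof. by rewrite expqD expqN. Qed.

Lemma expq0 i : 0 ^+ (q ^ i) = 0 :> A.
Proof. by rewrite expr0n expn_eq0; case: q q_gt1. Qed.

Lemma exp0q : 0 ^+ q = 0 :> A.
Proof. exact: expq0 1. Qed.

Lemma expq_sum i (I : Type) (r : seq I) (P : pred I) (G : I -> A) :
  (\sum_(j <- r | P j) G j) ^+ (q ^ i) = \sum_(j <- r | P j) G j ^+ (q ^ i).
Proof. exact: (big_morph _ (expqD i) (expq0 i)). Qed.

Lemma expqS i (x : A) : x ^+ (q ^ i) ^+ q = x ^+ (q ^ i.+1).
Proof. by rewrite -exprM expnSr. Qed.

Lemma flagopD u a s t : flagop u a (s + t) = flagop u a s + flagop u a t.
Proof.
elim: a s t => //= a IH s t; rewrite !IH -[q]expn1 expqD expn1; ring.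
Qed.

Lemma flagopZ u a c t : c ^+ q = c -> flagop u a (c * t) = c * flagop u a t.
Proof. by move=> cq; elim: a => //= a ->; rewrite exprMn cq; ring. Qed.

Lemma flagop0 u a : flagop u a 0 = 0.
Proof. by apply: (addrI (flagop u a 0)); rewrite -flagopD !addr0. Qed.

Lemma flagop_sum u a (I : Type) (r : seq I) (P : pred I) (G : I -> A) :
  flagop u a (\sum_(j <- r | P j) G j) = \sum_(j <- r | P j) flagop u a (G j).
Proof. exact: (big_morph _ (flagopD u a) (flagop0 u a)). Qed.

Lemma flagop_van u a b : (b < a)%N -> flagop u a (u b) = 0.
Proof.
elim: a => //= a IH; rewrite ltnS leq_eqVlt => /predU1P [->|/IH ->].
  by rewrite -exprSr prednK ?subrr // ltnW.
by rewrite expr0n mulr0 subr0; case: q q_gt1.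
Qed.

Lemma eq_flagop u v a t :
  (forall b, (b < a)%N -> u b = v b) -> flagop u a t = flagop v a t.
Proof.
elim: a t => //= a IH t uv.
have uva b : (b < a)%N -> u b = v b by move=> ba; apply: uv; apply: ltnW.
by rewrite uv // !IH.
Qed.

(* Adding to each [u b] a combination of the preceding ones does not change the
   space over which the product defining [flagop] runs. *)
Lemma flagop_unitriangular u v a t :
  (forall b, exists2 c : nat -> A, (forall d, c d ^+ q = c d) &
     v b = u b + \sum_(d < b) c d * u d) ->
  flagop v a t = flagop u a t.
Proof.
move=> uv; elim: a t => //= a IH t; rewrite !IH.
have [c cq ->] := uv a; rewrite flagopD flagop_sum big1 ?addr0 // => d _.
by rewrite flagopZ // flagop_van ?mulr0.
Qed.

Lemma orbprod_unitriangular u v a :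
  (forall b, exists2 c : nat -> A, (forall d, c d ^+ q = c d) &
     v b = u b + \sum_(d < b) c d * u d) ->
  orbprod v a = orbprod u a.
Proof.
move=> uv; rewrite /orbprod (flagop_unitriangular _ _ uv).
have [c cq ->] := uv a; rewrite flagopD flagop_sum big1 ?addr0 // => d _.
by rewrite flagopZ // flagop_van ?mulr0.
Qed.

(** The product over a span is taken in two stages: first over the line of [u 0], then over the
    images of the other vectors under E_1. *)
Lemma flagop_shift u a t :
  flagop u a.+1 t = flagop (fun b => flagop u 1 (u b.+1)) a (flagop u 1 t).
Proof. by elim: a t => [|a IH] t //=; rewrite -!IH. Qed.

Lemma orbprod_shift u a :
  orbprod u a.+1 = orbprod (fun b => flagop u 1 (u b.+1)) a.
Proof. exact: flagop_shift. Qed.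

(** With [u 0 = 0] the first step of the recursion is the q-th power map, which commutes with all
    later steps. This is how orbit products become q-th powers modulo the first coordinate. *)
Lemma flagop_shift0 u a t : u 0%N = 0 ->
  flagop u a.+1 t = flagop (fun b => u b.+1) a t ^+ q.
Proof.
move=> u0; elim: a t => [|a IH] t /=.
  by rewrite u0 expr0n -subn1 subn_eq0 leqNgt q_gt1 mul0r subr0.
rewrite -/(flagop u a.+1 t) -/(flagop u a.+1 (u a.+1)) !IH.
rewrite -[X in (_ - _) ^+ X]expn1 expqB expn1 exprMn; congr (_ - _ * _).
by rewrite -!exprM mulnC.
Qed.

Lemma flagcoef_gt N a l : (a < l)%N -> flagcoef N a l = 0.
Proof.
elim: a l => [|a IH] [|l] //= al.
by rewrite !IH ?exp0q ?mulr0 ?subrr //; lia.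
Qed.

Lemma flagcoef_top N a : flagcoef N a a = 1.
Proof.
by elim: a => //= a ->; rewrite flagcoef_gt // mulr0 subr0 expr1n.
Qed.

Lemma flagop_expand u a t :
  flagop u a t = \sum_(l < a.+1) flagcoef (orbprod u) a l * t ^+ (q ^ l).
Proof.
elim: a => [|a IH] /=; first by rewrite big_ord_recl big_ord0 /= mul1r addr0.
rewrite IH -/(orbprod u a) -[X in _ ^+ X - _]expn1 expq_sum.
under [RHS]eq_bigr do rewrite mulrBl; rewrite sumrB; congr (_ - _).
  rewrite [RHS]big_ord_recl mul0r add0r; apply: eq_bigr => l _ /=.
  by rewrite expn1 exprMn expqS.
rewrite [RHS]big_ord_recr /= flagcoef_gt // mulr0 mul0r addr0 mulr_sumr.
by apply: eq_bigr => l _; rewrite mulrA.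
Qed.

Lemma eq_flagcoef N N' a l : (forall b, (b < a)%N -> N b = N' b) ->
  flagcoef N a l = flagcoef N' a l.
Proof.
elim: a l => //= a IH l NN'.
have NNa b : (b < a)%N -> N b = N' b by move=> ba; apply: NN'; apply: ltnW.
by rewrite NN' // !IH //; case: l => // l; rewrite !IH.
Qed.

Lemma bil_sympform u m l i : bil u m l i = twist (sympform u m) l i.
Proof.
rewrite /twist; case: leqP => [il|li]; last have il := ltnW li.
  rewrite expq_sum; apply: eq_bigr => j _.
  by rewrite expqB !exprMn -!exprM -!expnD subnK.
rewrite expq_sum -sumrN; apply: eq_bigr => j _.
rewrite expqB !exprMn -!exprM -!expnD subnK //; ring.
Qed.

(** Both sides are the symplectic form on E_a and E_b of the generic point; the left one is its
    expansion by [flagop_expand] in both arguments. *)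
Lemma bil_flagop u m a b :
  relsum (orbprod u) (sympform u m) a b =
  \sum_(j < m) (flagop u a (u (m.*2.-1 - j)%N) * flagop u b (u j)
              - flagop u b (u (m.*2.-1 - j)%N) * flagop u a (u j)).
Proof.
rewrite /relsum; under eq_bigr do under eq_bigr do rewrite -bil_sympform mulr_sumr.
under eq_bigr do rewrite exchange_big /=.
rewrite exchange_big /=; apply: eq_bigr => j _; rewrite !flagop_expand.
rewrite [in X in _ = X - _]big_distrl [in X in _ = _ - X]big_distrr -sumrB.
apply: eq_bigr => l _; rewrite big_distrr big_distrl -sumrB.
by apply: eq_bigr => i _ /=; ring.
Qed.

Lemma relsum_top N X a b : relsum N X a b =
  \sum_(l < a) \sum_(i < b.+1) flagcoef N a l * flagcoef N b i * twist X l i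
  + \sum_(i < b) flagcoef N b i * twist X a i + twist X a b.
Proof.
rewrite {1}/relsum big_ord_recr /= -addrA; congr (_ + _).
rewrite big_ord_recr /= !flagcoef_top !mul1r; congr (_ + _).
by apply: eq_bigr => i _; rewrite mul1r.
Qed.

(** Since b <= m <= a, E_a kills every [u j] with j < m. In the remaining products E_b kills [u j]
    if j < b, and E_a kills its partner of index 2m - 1 - j < a if j >= b. *)
Lemma relsum_even u m a b : (b <= m)%N -> (a + b = m.*2)%N ->
  relsum (orbprod u) (sympform u m) a b = 0.
Proof.
move=> bm ab; rewrite bil_flagop big1 // => j _.
have jm := ltn_ord j; rewrite (@flagop_van u a j) ?mulr0 ?subr0; last by lia.
have [jb|bj] := ltnP j b; first by rewrite (@flagop_van u b j) ?mulr0.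
by rewrite flagop_van ?mul0r //; lia.
Qed.

(** The vanishing argument of [relsum_even] fails only for j = b, whose partner is [u a] itself. *)
Lemma relsum_odd u m a b : (b < m)%N -> (a + b = m.*2.-1)%N ->
  relsum (orbprod u) (sympform u m) a b = orbprod u a * orbprod u b.
Proof.
move=> bm ab; rewrite bil_flagop (bigD1 (Ordinal bm)) //= big1 ?addr0.
  rewrite (@flagop_van u a b) ?mulr0 ?subr0; last by lia.
  by congr (flagop _ _ (u _) * _); lia.
move=> j; rewrite -val_eqE /= => jb.
have jm := ltn_ord j; rewrite (@flagop_van u a j) ?mulr0 ?subr0; last by lia.
have [jltb|bj] := ltnP j b; first by rewrite (@flagop_van u b j) ?mulr0.
by rewrite flagop_van ?mul0r //; lia.
Qed.

Lemma sympform_shift0 u m i : u 0%N = 0 ->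
  sympform u m.+1 i = sympform (fun b => u b.+1) m i.
Proof.
move=> u0; rewrite /sympform big_ord_recl /= u0 expq0 !mulr0 subrr add0r.
apply: eq_bigr => j _; rewrite /bump add1n; have jm := ltn_ord j.
by have -> : ((m.*2).+1 - j.+1 = (m.*2.-1 - j).+1)%N by lia.
Qed.

(** Bilinear expansion of the form on E_1(t) = t^q - c t; it expresses the forms of the quotient
    coordinates through those of the original ones. *)
Lemma sympform_shift u m i : let X := sympform u m.+1 in let c := u 0%N ^+ q.-1 in
  sympform (fun b => flagop u 1 (u b.+1)) m i =
    twist X i.+1 1 - c * twist X i.+1 0 - c ^+ (q ^ i) * twist X i 1
    + c ^+ (q ^ i) * c * twist X i 0.
Proof.
(* As E_1 kills [u 0], the pair containing it contributes nothing; putting it back makes both sides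
   sums over the same pairs. *)
move=> X c; pose v b := if b is b'.+1 then flagop u 1 (u b) else 0.
rewrite -(@sympform_shift0 v) // -!bil_sympform /bil !mulr_sumr -!sumrB -big_split.
apply: eq_bigr => j _ /=; have jm := ltn_ord j.
have vE b : v b = u b ^+ q - c * u b.
  by case: b => //=; rewrite -exprSr prednK ?subrr // ltnW.
rewrite !vE !expqB !exprMn -!exprM -!expnS expn1 expn0 !expr1; ring.
Qed.

End Theory.

Section Morphism.
Variables (A B : comNzRingType) (f : {rmorphism A -> B}).
Implicit Types (u N X : nat -> A).

Lemma flagop_morph u a t : f (flagop u a t) = flagop (f \o u) a (f t).
Proof. by elim: a t => //= a IH t; rewrite rmorphB rmorphM !rmorphXn /= !IH. Qed.

Lemma orbprod_morph u a : f (orbprod u a) = orbprod (f \o u) a.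
Proof. exact: flagop_morph. Qed.

Lemma sympform_morph u m i : f (sympform u m i) = sympform (f \o u) m i.
Proof.
rewrite rmorph_sum; apply: eq_bigr => j _.
by rewrite rmorphB !rmorphM !rmorphXn.
Qed.

Lemma flagcoef_morph N a l : f (flagcoef N a l) = flagcoef (f \o N) a l.
Proof.
elim: a l => [|a IH] l /=; first by rewrite rmorph_nat.
rewrite rmorphB rmorphM rmorphXn /= IH; congr (_ - _).
by case: l => [|l]; rewrite ?rmorph0 // rmorphXn /= IH.
Qed.

End Morphism.

Section Frobenius.
Variables (A : comNzRingType) (p : nat) (pA : p \in [pchar A]).

Lemma frob_iter e : exists f : {rmorphism A -> A}, forall x, f x = x ^+ (p ^ e).
Proof.
elim: e => [|e [f fE]]; first by exists idfun => x; rewrite expr1.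
exists (pFrobenius_aut pA \o f) => x /=.
by rewrite pFrobenius_autE fE -exprM expnSr.
Qed.

Lemma flagop_frob u e a (t : A) :
  flagop u a t ^+ (p ^ e) = flagop (fun b => u b ^+ (p ^ e)) a (t ^+ (p ^ e)).
Proof.
have [f fE] := frob_iter e; rewrite -!fE flagop_morph.
by apply: eq_flagop => b _ /=; rewrite fE.
Qed.

End Frobenius.

End FlagOperators.

(** * Regular sequences with pure-power leading terms *)

Section Ideals.
Variable R : comNzRingType.
Implicit Types (r : seq R) (a b : R).

Lemma in_ideal0 r : in_ideal r 0.
Proof. by exists (fun => 0); rewrite big1 // => i _; rewrite mul0r. Qed.

Lemma in_idealD r a b : in_ideal r a -> in_ideal r b -> in_ideal r (a + b).
Proof.
move=> [c ->] [d ->]; exists (fun i => c i + d i); rewrite -big_split /=.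
by apply: eq_bigr => i _; rewrite mulrDl.
Qed.

Lemma in_idealM r a b : in_ideal r a -> in_ideal r (b * a).
Proof.
move=> [c ->]; exists (fun i => b * c i); rewrite mulr_sumr.
by apply: eq_bigr => i _; rewrite mulrA.
Qed.

Lemma in_ideal_mem r a : a \in r -> in_ideal r a.
Proof.
rewrite -index_mem => ar; exists (fun i => (i == Ordinal ar)%:R).
rewrite (bigD1 (Ordinal ar)) //= eqxx mul1r nth_index -?index_mem //.
by rewrite big1 ?addr0 // => i /negPf ->; rewrite mul0r.
Qed.

Lemma in_ideal_ind r (Q : R -> Prop) :
  Q 0 -> (forall a b, Q a -> Q b -> Q (a + b)) ->
  (forall a x, x \in r -> Q (a * x)) -> forall a, in_ideal r a -> Q a.
Proof.
move=> Q0 QD QM _ [c ->]; elim/big_ind: _ => // i _.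
by apply: QM; apply: mem_nth.
Qed.

End Ideals.

(** * Weights of monomials and leading terms *)

Section WeightBounds.
Variables (K : fieldType) (s : nat) (w : 'I_s -> nat).
Implicit Types (mu nu : 'X_{1..s}) (P Q : {mpoly K[s]}).

Definition wt mu := (\sum_i mu i * w i)%N.
Definition wtlt n P := forall mu, mu \in msupp P -> (wt mu < n)%N.

Lemma wtD mu nu : wt (mu + nu)%MM = (wt mu + wt nu)%N.
Proof. by rewrite -big_split; apply: eq_bigr => i _; rewrite mnmDE mulnDl. Qed.

Lemma wtU i e : wt (U_(i) *+ e)%MM = (e * w i)%N.
Proof.
rewrite /wt (bigD1 i) //= big1 ?addn0 => [|j ji].
  by rewrite mulmnE mnm1E eqxx mul1n.
by rewrite mulmnE mnm1E eq_sym (negPf ji).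
Qed.

Lemma wtlt0 n : wtlt n 0.
Proof. by move=> mu; rewrite msupp0. Qed.

Lemma wtltW n n' P : (n <= n')%N -> wtlt n P -> wtlt n' P.
Proof. by move=> nn' Pn mu /Pn /leq_trans; apply. Qed.

Lemma wtltD n P Q : wtlt n P -> wtlt n Q -> wtlt n (P + Q).
Proof. by move=> Pn Qn mu /msuppD_le; rewrite mem_cat => /orP [/Pn|/Qn]. Qed.

Lemma wtltN n P : wtlt n P -> wtlt n (- P).
Proof. by move=> Pn mu; rewrite (perm_mem (msuppN _)) => /Pn. Qed.

Lemma wtltB n P Q : wtlt n P -> wtlt n Q -> wtlt n (P - Q).
Proof. by move=> Pn /wtltN; apply: wtltD. Qed.

Lemma wtlt_sum n (I : Type) (r : seq I) (p : pred I) (G : I -> {mpoly K[s]}) :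
  (forall i, p i -> wtlt n (G i)) -> wtlt n (\sum_(i <- r | p i) G i).
Proof. by move=> Gn; elim/big_ind: _ => //; [exact: wtlt0|move=> *; exact: wtltD]. Qed.

Lemma wtltZ n c P : wtlt n P -> wtlt n (c *: P).
Proof. by move=> Pn mu /msuppZ_le /Pn. Qed.

(** All bounds are strict, so the successor on the second factor states a weak bound: one strict and
    one weak bound add up to a strict one. *)
Lemma wtltM n n' P Q : wtlt n P -> wtlt n'.+1 Q -> wtlt (n + n') (P * Q).
Proof.
move=> Pn Qn mu /msuppM_le /allpairsP [[m1 m2] /= [/Pn P1 /Qn Q1 ->]].
by rewrite wtD; lia.
Qed.

Lemma wtlt_X n mu : (wt mu < n)%N -> wtlt n 'X_[mu].
Proof. by move=> mun nu; rewrite msuppX inE => /eqP ->. Qed.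

Lemma wtltX n e P : wtlt n.+1 P -> wtlt (e * n).+1 (P ^+ e).
Proof.
move=> Pn; elim: e => [|e IH].
  by rewrite expr0 -mpolyX0; apply: wtlt_X; rewrite /wt big1 // => i _; rewrite mnm0E.
by rewrite exprS mulSn -addSn; apply: wtltM.
Qed.

Definition leads mu P := wtlt (wt mu) (P - 'X_[mu]).

Lemma leads_wtlt mu P : leads mu P -> wtlt (wt mu).+1 P.
Proof.
move=> muP; rewrite -[P](subrK 'X_[mu]); apply: wtltD; last exact: wtlt_X.
exact: wtltW muP.
Qed.

Lemma leads_X mu : leads mu 'X_[mu].
Proof. by rewrite /leads subrr; apply: wtlt0. Qed.

Lemma leadsM mu nu P Q : leads mu P -> leads nu Q -> leads (mu + nu)%MM (P * Q).
Proof.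
move=> muP nuQ; rewrite /leads wtD mpolyXD.
have -> : P * Q - 'X_[mu] * 'X_[nu] =
  (P - 'X_[mu]) * Q + (Q - 'X_[nu]) * 'X_[mu] by ring.
apply: wtltD; first by apply: wtltM => //; apply: leads_wtlt.
by rewrite addnC; apply: wtltM => //; apply: wtlt_X.
Qed.

Lemma leads_exp mu P e : leads mu P -> leads (mu *+ e)%MM (P ^+ e).
Proof.
move=> muP; elim: e => [|e IH]; first by rewrite mulm0n expr0 -mpolyX0; apply: leads_X.
by rewrite mulmS exprS; apply: leadsM.
Qed.

Lemma leads_prod (I : Type) (r : seq I) (G : I -> {mpoly K[s]}) (mu : I -> 'X_{1..s}) :
  (forall i, leads (mu i) (G i)) ->
  leads (\sum_(i <- r) mu i)%MM (\prod_(i <- r) G i).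
Proof.
move=> lG; elim: r => [|i r IH]; first by rewrite !big_nil -mpolyX0; apply: leads_X.
by rewrite !big_cons; apply: leadsM.
Qed.

Lemma wtltP0 P : wtlt 0 P -> P = 0.
Proof.
move=> P0; apply/eqP; rewrite -msupp_eq0.
by case suppP: (msupp P) => [|mu r] //; have := P0 mu; rewrite suppP mem_head => /(_ isT).
Qed.

End WeightBounds.

Lemma wtlt_subst (K : fieldType) (s t : nat) (w : 'I_s -> nat) (w' : 'I_t -> nat)
    (g : 'I_s -> {mpoly K[t]}) n P :
  (forall i, wtlt w' (w i).+1 (g i)) -> wtlt w n P -> wtlt w' n (subst g P).
Proof.
move=> gw Pn; rewrite substE big_seq; apply: wtlt_sum => mu muP; apply: wtltZ.
apply: (@wtltW _ _ _ (wt w mu).+1); first exact: Pn.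
rewrite /wt; elim/big_rec2: _ => [|i e Q _ IH].
  by rewrite -mpolyX0; apply: wtlt_X; rewrite /wt big1 // => i _; rewrite mnm0E.
by rewrite -addSn; apply: wtltM => //; apply: wtltX.
Qed.

(** * The triangular basis built from pure powers and relations *)

Section TriangularBasis.
Variables (K : fieldType) (s : nat) (w d : 'I_s -> nat).
Variable R : 'I_s -> {mpoly K[s]}.
Implicit Types (mu nu : 'X_{1..s}) (P Q : {mpoly K[s]}).

Definition trimon mu : {mpoly K[s]} :=
  \prod_i ('X_i ^+ (mu i %% d i) * R i ^+ (mu i %/ d i)).
Definition trimap P : {mpoly K[s]} := \sum_(mu <- msupp P) P@_mu *: trimon mu.

Hypothesis d_gt0 : forall i, (0 < d i)%N.
Hypothesis R_leads : forall i, leads w (U_(i) *+ d i)%MM (R i).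

Lemma trimap_supp P (L : seq 'X_{1..s}) : uniq L -> {subset msupp P <= L} ->
  trimap P = \sum_(mu <- L) P@_mu *: trimon mu.
Proof.
move=> uL PL; rewrite [RHS](bigID (mem (msupp P))) /= [X in _ + X]big1 ?addr0.
  rewrite -big_filter; apply: perm_big; apply: uniq_perm; rewrite ?filter_uniq //.
  move=> mu; rewrite mem_filter; case: (boolP (_ \in msupp P)) => //= /PL -> //.
by move=> mu /memN_msupp_eq0 ->; rewrite scale0r.
Qed.

Fact trimap_is_linear : linear trimap.
Proof.
move=> c P Q; pose L := undup (msupp P ++ msupp Q ++ msupp (c *: P + Q)).
have memL mu : mu \in L = [|| mu \in msupp P, mu \in msupp Q | mu \in msupp (c *: P + Q)].
  by rewrite mem_undup !mem_cat.
rewrite !(@trimap_supp _ L) ?undup_uniq // => [|mu|mu|mu]; try by rewrite memL => ->; rewrite ?orbT.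
rewrite scaler_sumr -big_split /=; apply: eq_bigr => mu _.
by rewrite mcoeffD mcoeffZ scalerDl scalerA.
Qed.
HB.instance Definition _ := GRing.isLinear.Build K _ _ _ trimap trimap_is_linear.

Lemma trimapXm mu : trimap 'X_[mu] = trimon mu.
Proof. by rewrite /trimap msuppX big_seq1 mcoeffX eqxx scale1r. Qed.

Lemma trimap1 : trimap 1 = 1.
Proof.
rewrite -[X in trimap X]mpolyX0 trimapXm /trimon big1 // => i _.
by rewrite mnm0E mod0n div0n !expr0 mulr1.
Qed.

Lemma trimapM i P : trimap ('X_i ^+ d i * P) = R i * trimap P.
Proof.
rewrite {1}[P]mpolyE mulr_sumr raddf_sum /= [in RHS]/trimap mulr_sumr.
apply: eq_bigr => mu _; rewrite -!scalerAr linearZ /=; congr (_ *: _).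
rewrite mpolyXn -mpolyXD trimapXm /trimon (bigD1 i) //= [in RHS](bigD1 i) //=.
rewrite mnmDE mulmnE mnm1E eqxx mul1n modnDl divnDl ?divnn // d_gt0 add1n exprS.
rewrite [X in _ * X = _](_ : _ =
  \prod_(j | j != i) ('X_j ^+ (mu j %% d j) * R j ^+ (mu j %/ d j))); first by ring.
apply: eq_bigr => j ji; rewrite mnmDE mulmnE mnm1E.
by rewrite eq_sym (negPf ji) mul0n add0n.
Qed.

Lemma trimon_leads mu : leads w mu (trimon mu).
Proof.
rewrite [X in leads _ X](_ : _ =
  \sum_(i < s) (U_(i) *+ (mu i %% d i) + U_(i) *+ d i *+ (mu i %/ d i)))%MM.
  apply: leads_prod => i; apply: leadsM; apply: leads_exp => //.
  exact: leads_X.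
rewrite {1}[mu]multinomUE_id; apply: eq_bigr => i _; apply/mnmP => j.
rewrite mnmDE !mulmnE [in LHS](divn_eq (mu i) (d i)); lia.
Qed.

Lemma trimap_inj : injective trimap.
Proof.
apply: raddf_inj => P P0; apply/eqP/negPn/negP => nzP.
(* A monomial of maximal weight in [P] cannot cancel: every other [trimon nu] differs from ['X_[nu]]
   only in weights below the maximum. *)
have [mu muP mu_max] : exists2 mu, mu \in msupp P &
    forall nu, nu \in msupp P -> (wt w nu <= wt w mu)%N.
  case def_r: (msupp P) => [|m0 r]; first by rewrite -msupp_eq0 def_r in nzP.
  have m0r : m0 \in m0 :: r by rewrite mem_head.
  have [] := @arg_maxnP (seq_sub (m0 :: r)) (SeqSub m0r) xpredT (fun x => wt w (ssval x)) isT.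
  move=> [mu mur] _ /= mu_max; exists mu => // nu nur.
  exact: (mu_max (SeqSub nur)).
have low nu : (wt w nu <= wt w mu)%N -> (trimon nu)@_mu = (nu == mu)%:R.
  move=> nu_mu; rewrite -[trimon nu](subrK 'X_[nu]) mcoeffD mcoeffX.
  rewrite memN_msupp_eq0 ?add0r //; apply/negP => muT; have := trimon_leads muT.
  by rewrite ltnNge nu_mu.
have: (trimap P)@_mu = 0 by rewrite P0 mcoeff0.
rewrite /trimap raddf_sum (bigD1_seq mu) ?msupp_uniq //= big1_seq ?addr0.
  by rewrite mcoeffZ low // eqxx mulr1; apply/eqP; rewrite mcoeff_eq0 negbK.
move=> nu /andP [numu nuP]; rewrite mcoeffZ low ?mu_max //.
by rewrite (negPf numu) mulr0.
Qed.

(** Induction on a weight bound: [P] and [trimap P] agree up to terms of smaller weight. *)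
Lemma trimap_surj P : exists Q, P = trimap Q.
Proof.
have [n Pn] : exists n, wtlt w n P.
  exists (\max_(mu <- msupp P) wt w mu).+1 => mu muP.
  by rewrite ltnS; apply: leq_bigmax_seq.
elim: n P Pn => [|n IH] P Pn.
  by exists 0; rewrite raddf0; apply: wtltP0 Pn.
have [|Q PQ] := IH (P - trimap P); last by exists (P + Q); rewrite raddfD /= -PQ; ring.
rewrite {1}[P]mpolyE /trimap -sumrB big_seq; apply: wtlt_sum => mu muP.
rewrite -scalerBr; apply: wtltZ.
rewrite -opprB; apply: wtltN.
by move: (@trimon_leads mu); apply: wtltW; have := Pn _ muP; rewrite ltnS.
Qed.

Definition reducible (l : seq 'I_s) mu := has (fun i => d i <= mu i)%N l.

(** Although [trimap] is not multiplicative, [trimapM] and bijectivity suffice to match the ideal of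
    the [R i] with the monomial ideal of the ['X_i ^+ d i], where membership is tested monomial by
    monomial. *)
Lemma in_ideal_trimap l P :
  in_ideal [seq R i | i <- l] (trimap P) <->
  (forall mu, mu \in msupp P -> reducible l mu).
Proof.
split=> [|Pl].
  pose Q a := exists2 P', a = trimap P' & forall mu, mu \in msupp P' -> reducible l mu.
  move/(@in_ideal_ind _ _ Q) => [||a x /mapP [i il ->]|P' /trimap_inj <- //].
  - by exists 0; rewrite ?raddf0 // => mu; rewrite msupp0.
  - move=> a b [A -> Al] [B -> Bl].
    exists (A + B); rewrite ?raddfD // => mu /msuppD_le.
    by rewrite mem_cat => /orP [/Al|/Bl].
  have [A ->] := trimap_surj a; exists ('X_i ^+ d i * A).
    by rewrite trimapM mulrC.
  move=> mu; rewrite mulrC mpolyXn (perm_mem (msuppMX _ _)) => /mapP [nu _ ->].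
  by apply/hasP; exists i => //; rewrite mnmDE mulmnE mnm1E eqxx mul1n leq_addr.
rewrite /trimap big_seq; elim/big_ind: _ => [|a b|mu /Pl /hasP [i il dmu]].
- exact: in_ideal0.
- exact: in_idealD.
rewrite -trimapXm -mul_mpolyC; apply: in_idealM.
have -> : mu = (U_(i) *+ d i + (mu - U_(i) *+ d i))%MM.
  rewrite addmC submK //; apply/mnm_lepP => j; rewrite mulmnE mnm1E.
  by case: eqP => [<-|_]; rewrite ?mul1n ?mul0n.
rewrite mpolyXD -mpolyXn trimapM mulrC; apply: in_idealM.
by apply: in_ideal_mem; apply: map_f.
Qed.

(** After transport by [trimap] the claim concerns pure powers of distinct variables: multiplying a
    monomial by a power of a new variable does not affect divisibility by the earlier powers. *)
Lemma triangular_regular (l : seq 'I_s) :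
  uniq l -> regular_sequence [seq R i | i <- l].
Proof.
move=> ul; split=> [k|]; last first.
  rewrite -trimap1 in_ideal_trimap -mpolyX0 => /(_ 0%MM).
  rewrite msuppX mem_head => /(_ isT) /hasP [i _].
  by rewrite mnm0E leqn0 => /eqP d0; have := d_gt0 i; rewrite d0.
rewrite size_map => kl a; have [A ->] := trimap_surj a; rewrite -map_take.
have i0 : 'I_s by case: l ul kl => // i.
rewrite (nth_map i0) // mulrC -trimapM => /in_ideal_trimap red.
apply/in_ideal_trimap => mu muA.
set j := nth i0 l k in red.
have /red /hasP [i il] : (U_(j) *+ d j + mu)%MM \in msupp ('X_j ^+ d j * A).
  rewrite mulrC mpolyXn (perm_mem (msuppMX _ _)) addmC.
  by apply/mapP; exists mu => //; rewrite addmC.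
rewrite mnmDE mulmnE mnm1E; case: (eqVneq j i) => [ji|_ dmu].
  have /hasPn/(_ j) : ~~ has (mem (take k l)) (drop k l).
    by move: ul; rewrite -{1}[l](cat_take_drop k) cat_uniq => /and3P [].
  by rewrite (drop_nth i0) // mem_head => /(_ isT) /negP []; rewrite /= ji.
by apply/hasP; exists i.
Qed.

Lemma triangular_normal_form (l : seq 'I_s) P :
  (forall i, i \notin l -> R i = 'X_i ^+ d i) ->
  exists2 B, in_ideal [seq R i | i <- l] (P - B) &
    forall mu, mu \in msupp B -> ~~ reducible l mu.
Proof.
move=> Rl; have [Q ->] := trimap_surj P.
(* The normal form keeps the irreducible monomials of the preimage. [trimap] fixes them: exponents
   in [l] are below [d i], and outside [l] the polynomial [R i] is the pure power itself. *)
pose B := \sum_(mu <- msupp Q | ~~ reducible l mu) Q@_mu *: 'X_[mu].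
have BE : B = trimap B.
  rewrite /B raddf_sum; apply: eq_bigr => mu /hasPn red /=.
  rewrite linearZ /= trimapXm mpolyXE_id; congr (_ *: _); apply: eq_bigr => i _.
  have [/red|/Rl ->] := boolP (i \in l).
    by rewrite -ltnNge => lt_mu; rewrite modn_small // divn_small // mulr1.
  by rewrite -exprM -exprD addnC mulnC -divn_eq.
exists B.
  rewrite BE -raddfB; apply/in_ideal_trimap => mu.
  rewrite (_ : Q - B = \sum_(nu <- msupp Q | reducible l nu) Q@_nu *: 'X_[nu]); last first.
    by rewrite {1}[Q]mpolyE (bigID (reducible l)) /= -/B addrK.
  move=> /msupp_sum_le.
  case/flattenP => m /mapP [nu]; rewrite mem_filter => /andP [rnu _] ->.
  by move=> /msuppZ_le; rewrite msuppX inE => /eqP ->.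
move=> mu /msupp_sum_le; case/flattenP => m /mapP [nu].
rewrite mem_filter => /andP [rnu _] ->.
by move=> /msuppZ_le; rewrite msuppX inE => /eqP ->.
Qed.

End TriangularBasis.

(** * The generators and their relations *)

Section OrderOfVanishing.
Variables (K : fieldType) (s : nat).
Implicit Types (P Q : {mpoly K[s]}).

(** Applied to the relations with e = 2: the absence of constant and linear terms is what makes the
    generators minimal. *)
Definition mord e P := forall mu, mu \in msupp P -> (e <= mdeg mu)%N.

Lemma mord0 e : mord e 0.
Proof. by move=> mu; rewrite msupp0. Qed.

Lemma mordD e P Q : mord e P -> mord e Q -> mord e (P + Q).
Proof. by move=> Pe Qe mu /msuppD_le; rewrite mem_cat => /orP [/Pe|/Qe]. Qed.

Lemma mordN e P : mord e P -> mord e (- P).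
Proof. by move=> Pe mu; rewrite (perm_mem (msuppN _)) => /Pe. Qed.

Lemma mordB e P Q : mord e P -> mord e Q -> mord e (P - Q).
Proof. by move=> Pe /mordN; apply: mordD. Qed.

Lemma mord_sum e (I : Type) (r : seq I) (p : pred I) (G : I -> {mpoly K[s]}) :
  (forall i, p i -> mord e (G i)) -> mord e (\sum_(i <- r | p i) G i).
Proof. by move=> Ge; elim/big_ind: _ => //; [exact: mord0|move=> *; exact: mordD]. Qed.

Lemma mordM e e' P Q : mord e P -> mord e' Q -> mord (e + e') (P * Q).
Proof.
move=> Pe Qe mu /msuppM_le /allpairsP [[m1 m2] /= [/Pe P1 /Qe Q1 ->]].
by rewrite mdegD leq_add.
Qed.

Lemma mordMl e P Q : mord e P -> mord e (P * Q).
Proof. by move=> Pe; rewrite -[e]addn0; apply: mordM. Qed.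

Lemma mordMr e P Q : mord e Q -> mord e (P * Q).
Proof. by move=> Pe; rewrite -[e]add0n; apply: mordM. Qed.

Lemma mordX e n P : mord e P -> mord (n * e) (P ^+ n).
Proof.
move=> Pe; elim: n => [|n IH]; first by rewrite mul0n.
by rewrite exprS mulSn; apply: mordM.
Qed.

Lemma mordX1 e n P : (0 < n)%N -> mord e P -> mord e (P ^+ n).
Proof.
move=> n0 /(mordX (n := n)) Pe mu /Pe; apply: leq_trans.
by rewrite leq_pmull.
Qed.

Lemma mord_var i : mord 1 ('X_i : {mpoly K[s]}).
Proof. by move=> mu; rewrite msuppX inE => /eqP ->; rewrite mdeg1. Qed.

End OrderOfVanishing.

(** * Generators, relations and their weights at each level *)

Section Levels.
Variables (F : finFieldType) (m : nat).
Notation q := #|F|.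
Notation S := {mpoly F[m + m]}.
Notation s := (2 * m - 2 + (m + m))%N.
Variables (p r : nat) (p_pr : prime p) (cardF : q = (p ^ r)%N).
Notation T := {mpoly F[s]}.

(* [flagvar] lists the coordinates as x_1, ..., x_m, y_m, ..., y_1, so that each
   generator N(x_i) or N_k(y_k) is the orbit product of a variable over the span of
   the preceding ones. *)
Definition flagvar (a : nat) : S :=
  if insub a is Some i then 'X_(rev_ord i) else 0.

Definition nvar (a : nat) : T :=
  if insub a is Some i then 'X_(rshift (2 * m - 2) i) else 0.

Definition xvar (l : nat) : T :=
  if l is j.+1 then if insub j is Some i then 'X_(lshift (m + m) i) else 0 else 0.

(* At level [k] the pairs (x_j, y_j) with [j < k], 0-based, are removed: their
   coordinates are kept as extra generators and [2 (m - k)] variables remain. *)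
Definition level (k b : nat) : S := flagvar (k + b).

(** One polynomial ring [T] serves all levels: a form of too large index is sent to 0, and
    [relation] gives its variable as the corresponding relation. *)
Definition gens k (i : 'I_s) : S :=
  match split i with
  | inl j => if (j.+1 <= (m - k).*2 - 2)%N then sympform q (level k) (m - k) j.+1 else 0
  | inr a => if (k <= a < m + m - k)%N then orbprod q (level k) (a - k)
             else flagvar a
  end.

Definition evg k : T -> S := subst (gens k).
HB.instance Definition _ k := GRing.RMorphism.on (evg k).
HB.instance Definition _ k := GRing.Linear.on (evg k).

Definition lnvar k b : T := nvar (k + b).

(* For [l = 2 (m - k) - 1] the invariant xi_l is not a generator; it is expressed
   through the generators by the relation with [b = 0]. *)
Definition xforms k (l : nat) : T :=
  let n := (m - k).*2.-1 in
  if (l < n)%N then xvar l else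
    lnvar k n * lnvar k 0 - \sum_(i < n) flagcoef q (lnvar k) n i * xvar i.

(** With a = b + j + 1 this b makes a + b equal to 2(m - k) or 2(m - k) - 1, according to the parity
    of j + 1. *)
Definition relb k (j : nat) := ((m - k).*2 - j.+1)./2.

Definition relation k (i : 'I_s) : T :=
  match split i with
  | inl j =>
    let b := relb k j in
    if (j.+1 <= (m - k).*2 - 2)%N then
      relsum q (lnvar k) (xforms k) (b + j.+1) b
      - (if odd j.+1 then lnvar k (b + j.+1) * lnvar k b else 0)
    else 'X_i
  | inr a => 'X_i
  end.

Definition reldeg k (i : 'I_s) : nat :=
  match split i with inl j => (q ^ relb k j)%N | inr a => 1%N end.

(* One less than the degree for the [N] variables, so that in a relation, homogeneous
   for the degree, every monomial involving them weighs less than the pure power. *)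
Definition relwt k (i : 'I_s) : nat :=
  match split i with inl j => (q ^ j.+1 + 1)%N | inr a => (q ^ (a - k) - 1)%N end.

Lemma split_lshift a b (j : 'I_a) : split (lshift b j) = inl j.
Proof. exact: (unsplitK (inl _)). Qed.

Lemma split_rshift a b (j : 'I_b) : split (rshift a j) = inr j.
Proof. exact: (unsplitK (inr _)). Qed.

Lemma flagvarE a (h : (a < m + m)%N) : flagvar a = 'X_(rev_ord (Ordinal h)).
Proof. by rewrite /flagvar insubT. Qed.

Lemma nvarE a (h : (a < m + m)%N) : nvar a = 'X_(rshift (2 * m - 2) (Ordinal h)).
Proof. by rewrite /nvar insubT. Qed.

Lemma xvarE j (h : (j < 2 * m - 2)%N) : xvar j.+1 = 'X_(lshift (m + m) (Ordinal h)).
Proof. by rewrite /xvar insubT. Qed.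

Lemma q_gt1 : (1 < q)%N.
Proof. exact: finNzRing_gt1. Qed.

Lemma q_gt0 : (0 < q)%N. Proof. exact: ltnW q_gt1. Qed.

Lemma qexp_gt0 e : (0 < q ^ e)%N. Proof. by rewrite expn_gt0 q_gt0. Qed.

Lemma pnat_qmpoly n : [pchar {mpoly F[n]}].-nat q.
Proof.
have pA : p \in [pchar {mpoly F[n]}].
  have pF := card_finPcharP cardF p_pr; rewrite inE p_pr /=.
  by rewrite -mpolyC_nat (pcharf0 pF).
by rewrite cardF pnatX pnatE ?pA.
Qed.

Lemma evg_nvar k a : (k <= a < m + m - k)%N -> evg k (nvar a) = orbprod q (level k) (a - k).
Proof.
move=> ka; have h : (a < m + m)%N by lia.
by rewrite (nvarE h) /evg substX /gens split_rshift ka.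
Qed.

Lemma evg_nvar_out k a : ~~ (k <= a < m + m - k)%N -> evg k (nvar a) = flagvar a.
Proof.
move=> ka; have [h|h] := ltnP a (m + m).
  by rewrite (nvarE h) /evg substX /gens split_rshift (negPf ka).
by rewrite /nvar /flagvar !insubF ?rmorph0 // ltnNge h.
Qed.

Lemma evg_lnvar k b : (b < (m - k).*2)%N -> evg k (lnvar k b) = orbprod q (level k) b.
Proof.
by move=> bk; rewrite /lnvar evg_nvar; [congr orbprod|]; lia.
Qed.

Lemma sympform0 (A : comNzRingType) (u : nat -> A) n : sympform q u n 0 = 0.
Proof. by rewrite /sympform big1 // => j _; rewrite expn0 !expr1 subrr. Qed.

Lemma evg_xvar k l : (l < (m - k).*2.-1)%N -> evg k (xvar l) = sympform q (level k) (m - k) l.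
Proof.
case: l => [|j] jk; first by rewrite sympform0 rmorph0.
have h : (j < 2 * m - 2)%N by lia.
rewrite (xvarE h) /evg substX /gens split_lshift ifT //=; lia.
Qed.

Lemma evg_flagcoef k a l : (a <= (m - k).*2)%N ->
  evg k (flagcoef q (lnvar k) a l) = flagcoef q (orbprod q (level k)) a l.
Proof.
move=> ak; rewrite flagcoef_morph; apply: eq_flagcoef => b ba /=.
by rewrite evg_lnvar //; apply: leq_trans ba ak.
Qed.

Lemma evg_xforms k l : (l < (m - k).*2)%N ->
  evg k (xforms k l) = sympform q (level k) (m - k) l.
Proof.
move=> lk; rewrite /xforms; case: ifP => ln; first exact: evg_xvar.
have -> : l = (m - k).*2.-1 by lia.
set n := _.-1; have nk : (n < (m - k).*2)%N by rewrite /n; lia.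
have qS := pnat_qmpoly (m + m); have q1 := q_gt1.
have := @relsum_odd _ _ qS q1 (level k) (m - k) n 0.
rewrite addn0 => /(_ _ erefl) rel; have {rel} := rel ltac:(lia).
rewrite /relsum big_ord_recr /= big_ord_recl big_ord0 /= addr0.
rewrite flagcoef_top // !mul1r /twist /= subn0 expn0 expr1 => rel.
rewrite rmorphB rmorphM /= !evg_lnvar //; last by lia.
rewrite -rel rmorph_sum addrC -addrA -sumrB -[RHS]addr0; congr (_ + _).
apply: big1 => i _; rewrite big_ord_recl big_ord0 /= mulr1 addr0 subn0 expn0 expr1.
have in_ := ltn_ord i.
by rewrite rmorphM /= evg_flagcoef 1?ltnW // evg_xvar // subrr.
Qed.

Lemma relb_bounds k j : (j.+1 <= (m - k).*2 - 2)%N ->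
  [/\ (0 < relb k j)%N, (relb k j < m - k)%N, (relb k j + j.+1 < (m - k).*2)%N &
     (relb k j + j.+1 + relb k j = if odd j.+1 then (m - k).*2.-1 else (m - k).*2)%N].
Proof.
move=> jk; have := odd_double_half ((m - k).*2 - j.+1).
rewrite -/(relb k j) oddB ?odd_double /=; last by lia.
by case: (odd j) => /=; split; lia.
Qed.

Lemma evg_relation k j : evg k (relation k (lshift (m + m) j)) = 0.
Proof.
rewrite /relation split_lshift; case: ifP => [jk|jk]; last first.
  by rewrite /evg substX /gens split_lshift jk.
have [b0 bk ak ab] := relb_bounds jk; set b := relb k j in b0 bk ak ab *.
have evsum : evg k (relsum q (lnvar k) (xforms k) (b + j.+1) b) =
  relsum q (orbprod q (level k)) (sympform q (level k) (m - k)) (b + j.+1) b.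
  rewrite rmorph_sum /=; apply: eq_bigr => l _; rewrite rmorph_sum /=; apply: eq_bigr => i _.
  have li := ltn_ord l; have ii := ltn_ord i.
  rewrite !rmorphM /= !evg_flagcoef; try lia.
  by congr (_ * _); rewrite /twist; case: ifP => _; rewrite ?rmorphN rmorphXn /= evg_xforms //; lia.
have evB x y : evg k (x - y) = evg k x - evg k y by exact: rmorphB.
rewrite evB evsum; case: (odd j.+1) ab => ab.
  rewrite relsum_odd ?pnat_qmpoly ?q_gt1 // (rmorphM (evg k)) /= !evg_lnvar ?subrr //; lia.
by rewrite (rmorph0 (evg k)) subr0 relsum_even ?pnat_qmpoly ?q_gt1 //; lia.
Qed.

Lemma lnvar_wt k b : wtlt (relwt k) (q ^ b) (lnvar k b).
Proof.
have qb := qexp_gt0 b.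
rewrite /lnvar; have [h|h] := ltnP (k + b) (m + m); last first.
  by rewrite /nvar insubF; [apply: wtlt0|rewrite ltnNge h].
rewrite (nvarE h); apply: wtlt_X.
have := wtU (relwt k) (rshift (2 * m - 2) (Ordinal h)) 1.
rewrite mulm1n mul1n => ->; rewrite /relwt split_rshift /= addKn.
by rewrite subn1 prednK.
Qed.

(** The coefficient is homogeneous of degree q^a - q^l, and for l < a each of its monomials contains
    an N, whose weight is below its degree. For l = a it is 1, whence the correction term. *)
Lemma flagcoef_wt k a l : (l <= a)%N ->
  wtlt (relwt k) (q ^ a - q ^ l + (l == a)) (flagcoef q (lnvar k) a l).
Proof.
elim: a l => [|a IH] l /= la.
  move: la; rewrite leqn0 => /eqP -> /=; rewrite -mpolyX0; apply: wtlt_X.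
  by rewrite /wt big1 // => i _; rewrite mnm0E.
have qS := pnat_qmpoly s; have q1 := q_gt1; have qa := qexp_gt0 a.
have wX n e (P : T) : (0 < n)%N -> wtlt (relwt k) n P -> wtlt (relwt k) (e * n.-1).+1 (P ^+ e).
  by case: n => // n _; apply: wtltX.
apply: wtltB.
  case: l la => [|l] la; first exact: wtlt0.
  have {}la : (l <= a)%N by []; have ql := qexp_gt0 l.
  have lea : (q ^ l <= q ^ a)%N by rewrite leq_exp2l.
  rewrite eqSS; move: (IH l la); case: eqP => [-> | /eqP nla] IHl.
    move: IHl; rewrite subnn => IHl; move: (wX 1%N q _ isT IHl).
    by apply: wtltW; rewrite /= muln0 subnn.
  have lta : (q ^ l < q ^ a)%N by rewrite ltn_exp2l // ltn_neqAle nla.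
  rewrite addn0 in IHl; have w0 : (0 < q ^ a - q ^ l)%N by rewrite subn_gt0.
  move: (wX _ q _ w0 IHl).
  apply: wtltW; rewrite !expnS addn0.
  move: (q ^ a)%N (q ^ l)%N lta q1; move: q => c x y; clear; nia.
case: (ltngtP l a.+1) la => // [la | ->] _; last first.
  by rewrite flagcoef_gt ?mulr0 //; apply: wtlt0.
have {}la : (l <= a)%N by []; have ql := qexp_gt0 l.
have lea : (q ^ l <= q ^ a)%N by rewrite leq_exp2l.
have NX : wtlt (relwt k) (q.-1 * (q ^ a).-1).+1 (lnvar k a ^+ q.-1).
  exact: (wX _ _ _ qa (@lnvar_wt k a)).
rewrite mulrC; move: (wtltM (IH l la) NX); apply: wtltW; rewrite addn0 expnS.
case: eqP => [-> | _]; move: (q ^ a)%N (q ^ l)%N lea qa q1; move: q => c x y; clear; nia.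
Qed.

Lemma flagcoef_wtS k a l : (l <= a)%N ->
  wtlt (relwt k) (q ^ a - q ^ l).+1 (flagcoef q (lnvar k) a l).
Proof.
move=> la; move: (@flagcoef_wt k _ _ la); apply: wtltW.
by rewrite -addn1 leq_add2l; case: eqP.
Qed.

Lemma xvar_wt k l : wtlt (relwt k) (q ^ l + 2) (xvar l).
Proof.
case: l => [|j]; first exact: wtlt0.
have [h|h] := ltnP j (2 * m - 2); last first.
  by rewrite /xvar insubF; [apply: wtlt0|rewrite ltnNge h].
rewrite (xvarE h); apply: wtlt_X.
have := wtU (relwt k) (lshift (m + m) (Ordinal h)) 1.
by rewrite mulm1n mul1n => ->; rewrite /relwt split_lshift addn2 addn1.
Qed.

Lemma xforms_wt k l : wtlt (relwt k) (q ^ l + 2) (xforms k l).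
Proof.
rewrite /xforms; set n := _.-1; case: ltnP => ln; first exact: xvar_wt.
have qnl : (q ^ n <= q ^ l)%N by rewrite leq_exp2l // q_gt1.
apply: (@wtltW _ _ _ (q ^ n + 2)); first by rewrite leq_add2r.
apply: wtltB.
  apply: (@wtltW _ _ _ (q ^ n + 1)); first by lia.
  apply: wtltM; first exact: lnvar_wt.
  by apply: wtltW (@lnvar_wt k 0).
apply: wtlt_sum => i _; have i_n : (i <= n)%N by rewrite ltnW.
have qin : (q ^ i <= q ^ n)%N by rewrite leq_exp2l // q_gt1.
apply: (@wtltW _ _ _ ((q ^ n - q ^ i).+1 + (q ^ i + 1))).
  by move: (q ^ n)%N (q ^ i)%N qin => x y; clear; lia.
apply: wtltM; first exact: flagcoef_wtS.
by move: (@xvar_wt k i); apply: wtltW; rewrite addn2 addn1.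
Qed.

Lemma twist_wt k l i : wtlt (relwt k) (q ^ l + q ^ i).+1 (twist q (xforms k) l i).
Proof.
wlog il : l i / (i <= l)%N => [Hw|].
  have [/Hw //|li] := leqP i l; have il := ltnW li.
  rewrite (addnC (q ^ l)%N); move: (Hw _ _ il); rewrite /twist il leqNgt li /=.
  by move/wtltN.
rewrite /twist il.
have := @wtltX _ _ _ (q ^ (l - i) + 1)%N (q ^ i) (xforms k (l - i)).
move=> /(_ (relwt k)); rewrite mulnDr -expnD subnKC // muln1; apply.
by move: (@xforms_wt k (l - i)); apply: wtltW; rewrite addn2 addn1.
Qed.

(** The leading monomial has weight q^a + q^b. Any other term of the expansion contains a
    coefficient with l < a or i < b, for which [flagcoef_wt] is strict, and N_a N_b weighs two
    less. *)
Lemma relation_leads k i :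
  leads (relwt k) (U_(i) *+ reldeg k i)%MM (relation k i).
Proof.
rewrite /leads wtU /reldeg /relation {2}/relwt; case: split_ordP => [j ->|a ->]; last first.
  by rewrite mulm1n subrr; apply: wtlt0.
case: ifP => [jk|jk]; last first.
  rewrite (_ : relb k j = 0%N) ?mulm1n ?subrr; first exact: wtlt0.
  by rewrite /relb; lia.
have [b0 bk ak ab] := relb_bounds jk; set b := relb k j in b0 bk ak ab *.
set a := (b + j.+1)%N; rewrite mulnDr muln1 -expnD -/a.
have qS := pnat_qmpoly (2 * m - 2 + (m + m)); have q1 := q_gt1.
rewrite relsum_top //.
have -> : twist q (xforms k) a b = 'X_[U_(lshift (m + m) j) *+ q ^ b].
  rewrite /twist leq_addr addKn /xforms ifT; last by lia.
  rewrite -mpolyXn; congr (_ ^+ _); rewrite (xvarE (ltn_ord j)).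
  by congr ('X_(lshift _ _)); apply: val_inj.
rewrite addrAC addrK.
apply: wtltD; last first.
  apply: wtltN; case: (odd j.+1); last exact: wtlt0.
  apply: wtltM; first exact: lnvar_wt.
  by move: (@lnvar_wt k b); apply: wtltW.
have le_q x y : (x <= y)%N -> (q ^ x <= q ^ y)%N by move=> xy; rewrite leq_exp2l.
apply: wtltD; apply: wtlt_sum => l _.
  apply: wtlt_sum => i' _; have la := ltn_ord l; have ib : (i' <= b)%N by rewrite -ltnS.
  have qla := le_q _ _ (ltnW la); have qib := le_q _ _ ib.
  apply: (@wtltW _ _ _ ((q ^ a - q ^ l) + (q ^ b - q ^ i') + (q ^ l + q ^ i'))).
    by move: (q ^ a)%N (q ^ b)%N (q ^ l)%N (q ^ i')%N qla qib => *; lia.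
  apply: wtltM; last exact: twist_wt.
  apply: wtltM; last exact: flagcoef_wtS.
  by move: (@flagcoef_wt k _ _ (ltnW la)); rewrite (ltn_eqF la) addn0.
have lb := ltn_ord l; have qlb := le_q _ _ (ltnW lb).
apply: (@wtltW _ _ _ ((q ^ b - q ^ l) + (q ^ a + q ^ l))).
  by move: (q ^ a)%N (q ^ b)%N (q ^ l)%N qlb => *; lia.
apply: wtltM; last exact: twist_wt.
by move: (@flagcoef_wt k _ _ (ltnW lb)); rewrite (ltn_eqF lb) addn0.
Qed.

Lemma reldeg_gt0 k i : (0 < reldeg k i)%N.
Proof. by rewrite /reldeg; case: split => // j; apply: qexp_gt0. Qed.

Definition xindices : seq 'I_s := [seq lshift (m + m) j | j : 'I_(2 * m - 2)].

Lemma relation_nvar k i : i \notin xindices -> relation k i = 'X_i ^+ reldeg k i.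
Proof.
rewrite /relation /reldeg; case: split_ordP => // j ->.
by rewrite (map_f (@lshift _ (m + m))) // mem_enum.
Qed.

Lemma xindices_uniq : uniq xindices.
Proof. by rewrite map_inj_uniq ?enum_uniq //; apply: lshift_inj. Qed.

Definition xbounded k e (P : T) := forall mu, mu \in msupp P ->
  forall j, (mu (lshift (m + m) j) < e * reldeg k (lshift (m + m) j))%N.

Lemma not_reducible k mu : ~~ reducible (reldeg k) xindices mu ->
  forall j, (mu (lshift (m + m) j) < reldeg k (lshift (m + m) j))%N.
Proof.
move=> /hasPn red j; rewrite ltnNge; apply: red.
by apply: map_f; rewrite mem_enum.
Qed.

Lemma evg_ideal k P : in_ideal [seq relation k i | i <- xindices] P -> evg k P = 0.
Proof.
move: P; apply: in_ideal_ind; first exact: rmorph0.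
  by move=> P Q P0 Q0; rewrite rmorphD /= P0 Q0 addr0.
move=> P x /mapP [i /mapP [j _ ->] ->]; rewrite rmorphM /= evg_relation mulr0 //.
Qed.

Lemma normal_form k P : exists2 B,
  in_ideal [seq relation k i | i <- xindices] (P - B) & xbounded k 1 B.
Proof.
have [B PB redB] := @triangular_normal_form _ _ _ _ _ (@reldeg_gt0 k)
  (@relation_leads k) xindices P (@relation_nvar k).
exists B => // mu /redB /not_reducible muB j.
by rewrite mul1n.
Qed.

Lemma evg_normal_form k P : exists2 B, evg k P = evg k B & xbounded k 1 B.
Proof.
have [B /evg_ideal PB redB] := normal_form k P; exists B => //.
by apply/eqP; rewrite -subr_eq0 -PB rmorphB.
Qed.

Lemma nvar_mord k b : mord 1 (lnvar k b).
Proof.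
rewrite /lnvar /nvar; case: insubP => [i _ _|_]; [exact: mord_var|exact: mord0].
Qed.

Lemma flagcoef_mord k a l : (l < a)%N -> mord 1 (flagcoef q (lnvar k) a l).
Proof.
elim: a l => // a IH l la /=; apply: mordB; last first.
  by apply: mordMl; apply: mordX1; [have := q_gt1; case: q => [|[]] | exact: nvar_mord].
case: l la => [|l] la; first exact: mord0.
by apply: mordX1; [exact: q_gt0 | exact: IH].
Qed.

Lemma xvar_mord l : mord 1 (xvar l).
Proof.
case: l => [|j] /=; first exact: mord0.
case: insubP => [i _ _|_]; [exact: mord_var|exact: mord0].
Qed.

Lemma xforms_mord k l : mord 1 (xforms k l).
Proof.
rewrite /xforms; case: ifP => _; first exact: xvar_mord.
apply: mordB; first by apply: mordMl; apply: nvar_mord.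
by apply: mord_sum => i _; apply: mordMr; apply: xvar_mord.
Qed.

Lemma twist_mord k l i : mord 1 (twist q (xforms k) l i).
Proof.
rewrite /twist; case: ifP => _; first by apply: mordX1; [exact: qexp_gt0|exact: xforms_mord].
by apply: mordN; apply: mordX1; [exact: qexp_gt0|exact: xforms_mord].
Qed.

(** Every term has two factors vanishing at the origin; the leading one is a power with exponent
    q^b, and b > 0. *)
Lemma relation_mord k (j : 'I_(2 * m - 2)) : (j.+1 <= (m - k).*2 - 2)%N ->
  mord 2 (relation k (lshift (m + m) j)).
Proof.
move=> jk; rewrite /relation split_lshift jk.
have [b0 bk ak ab] := relb_bounds jk; set b := relb k j in b0 bk ak ab *.
apply: mordB; last first.
  case: (odd _); last exact: mord0.
  by apply: (@mordM _ _ 1 1); apply: nvar_mord.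
apply: mord_sum => l _; apply: mord_sum => i _.
have := ltn_ord l; rewrite ltnS leq_eqVlt => /predU1P [la|la]; last first.
  by apply: (@mordM _ _ 1 1); [apply: mordMl; apply: flagcoef_mord|apply: twist_mord].
have := ltn_ord i; rewrite ltnS leq_eqVlt => /predU1P [ib|ib]; last first.
  by apply: (@mordM _ _ 1 1); [apply: mordMr; apply: flagcoef_mord|apply: twist_mord].
apply: mordMr; rewrite /twist ib la leq_addr.
have := mordX (n := q ^ b) (@xforms_mord k (b + j.+1 - b)%N).
move=> mo mu /mo; apply: leq_trans; rewrite muln1.
by apply: leq_trans q_gt1 _; rewrite -{1}[q]expn1 leq_exp2l ?q_gt1.
Qed.

End Levels.

(** * Algebraic independence modulo the relations *)

(** Nonsingularity of a Moore matrix. Subtracting [g n] times E_n from the additive polynomial with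
    coefficients [g] leaves one of lower degree with roots w_0, ..., w_(n-1), zero by induction;
    evaluation at w_n then gives g_n N_n = 0. *)
Lemma moore_regular (q : nat) (A : idomainType) (w : nat -> A) n (g : nat -> A) :
  [pchar A].-nat q -> (1 < q)%N -> (forall a, (a < n)%N -> orbprod q w a != 0) ->
  (forall b, (b < n)%N -> \sum_(i < n) g i * w b ^+ (q ^ i) = 0) ->
  forall i, (i < n)%N -> g i = 0.
Proof.
move=> qA q1; elim: n g => // n IH g Nn gw.
pose g' i := g i - g n * flagcoef q (orbprod q w) n i.
have g'E b : \sum_(i < n) g' i * w b ^+ (q ^ i) =
    \sum_(i < n.+1) g i * w b ^+ (q ^ i) - g n * flagop q w n (w b).
  rewrite flagop_expand // !big_ord_recr /= flagcoef_top // mul1r mulrDr.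
  rewrite opprD addrACA subrr addr0 mulr_sumr -sumrB; apply: eq_bigr => i _.
  by rewrite /g' mulrBl mulrA.
have g'0 i : (i < n)%N -> g' i = 0.
  apply: IH => [a an|b bn]; first by apply: Nn; apply: ltnW.
  by rewrite g'E gw ?flagop_van // ?mulr0 ?subr0 // ltnW.
have gn0 : g n = 0.
  have := g'E n; rewrite gw // big1 => [|i _]; last by rewrite g'0 // mul0r.
  move/eqP; rewrite eq_sym sub0r oppr_eq0 mulf_eq0 => /orP [/eqP //|].
  by rewrite -/(orbprod q w n) (negPf (Nn _ (leqnn _))).
move=> i; rewrite ltnS leq_eqVlt => /predU1P [-> //|/g'0].
by rewrite /g' gn0 mul0r subr0.
Qed.

Section Freeness.
Variables (K : fieldType) (n : nat) (i : 'I_n).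
Implicit Types f g : {mpoly K[n]}.

Lemma free_of0 : free_of i (0 : {mpoly K[n]}).
Proof. by rewrite /free_of rmorph0. Qed.
Lemma free_ofX j : j != i -> free_of i ('X_j : {mpoly K[n]}).
Proof. by rewrite /free_of subst1X => /negPf ->. Qed.

Lemma free_of_flagop q (u : nat -> {mpoly K[n]}) a t : (forall b, (b < a)%N -> free_of i (u b)) ->
  free_of i t -> free_of i (flagop q u a t).
Proof.
move=> fu ft; rewrite /free_of flagop_morph /= ft.
by apply: eq_flagop => b ba /=; apply: fu.
Qed.

Lemma size_uni_lin q a (c : nat -> {mpoly K[n]}) : (1 < q)%N ->
  (forall l, (l <= a)%N -> free_of i (c l)) -> c a = 1 ->
  (q ^ a < size (uni i (\sum_(l < a.+1) c l * 'X_i ^+ (q ^ l))))%N.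
Proof.
move=> q1 cfree ca; rewrite ltnNge; apply/negP => /leq_sizeP /(_ _ (leqnn _)).
rewrite rmorph_sum coef_sum big_ord_recr /= big1 => [|l _].
  rewrite add0r ca mul1r rmorphXn /= uniX eqxx coefXn eqxx => /eqP.
  by rewrite oner_eq0.
have la := ltn_ord l.
rewrite rmorphM rmorphXn /= uniX eqxx uni_free; last by apply: cfree; apply: ltnW.
by rewrite coefCM coefXn eqn_exp2l // gtn_eqF // mulr0.
Qed.

End Freeness.

(** * Descending induction on the level for independence *)

Section Independence.
Variables (F : finFieldType) (m : nat).
Notation q := #|F|.
Notation S := {mpoly F[m + m]}.
Notation s := (2 * m - 2 + (m + m))%N.
Variables (p r : nat) (p_pr : prime p) (r_gt0 : (0 < r)%N) (cardF : q = (p ^ r)%N).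
Notation T := {mpoly F[s]}.

Let q1 : (1 < q)%N := @q_gt1 F.
Let qA n : [pchar {mpoly F[n]}].-nat q := pnat_qmpoly p_pr cardF n.
Let pF : p \in [pchar F] := card_finPcharP cardF p_pr.

Lemma pchar_mpoly n : p \in [pchar {mpoly F[n]}].
Proof. by rewrite inE p_pr /= -mpolyC_nat (pcharf0 pF). Qed.

Lemma flagvar_free a b (h : (b < m + m)%N) : a != b ->
  free_of (rev_ord (Ordinal h)) (flagvar F m a).
Proof.
move=> ab; have [ha|ha] := ltnP a (m + m).
  rewrite (flagvarE _ ha); apply: free_ofX; rewrite (inj_eq rev_ord_inj) -val_eqE //.
by rewrite /flagvar insubF; [apply: free_of0|rewrite ltnNge ha].
Qed.

Lemma flagvar_neq0 a : (a < m + m)%N -> flagvar F m a != 0.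
Proof. by move=> h; rewrite (flagvarE _ h) -msize_poly_eq0 msizeX. Qed.

(** As a polynomial in its last coordinate the orbit product is monic of positive degree. *)
Lemma orbprod_neq0 k a : (k + a < m + m)%N -> orbprod q (level F m k) a != 0.
Proof.
move=> h; rewrite /orbprod flagop_expand ?qA // /level (flagvarE _ h).
set i := rev_ord _; have: (0 < size (uni i (\sum_(l < a.+1)
   flagcoef q (orbprod q (level F m k)) a l * 'X_i ^+ (q ^ l))))%N.
  apply: leq_trans (size_uni_lin q1 _ _) => [//|l la|]; last by rewrite flagcoef_top ?qA.
  rewrite /free_of flagcoef_morph; apply: eq_flagcoef => b ba /=.
  have fb d : (d <= b)%N -> free_of i (level F m k d).
    by move=> db; apply: flagvar_free; rewrite neq_ltn ltn_add2l (leq_ltn_trans db ba).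
  by apply: free_of_flagop; [move=> d /ltnW|]; apply: fb.
by apply: contraTneq => ->; rewrite rmorph0 size_poly0.
Qed.

(** At level m all relation degrees are 1, so a bounded polynomial contains no form variable, and
    the other variables are sent to distinct coordinates; [back] inverts this. *)
Lemma independence_base (P : T) : xbounded m 1 P -> evg m P = 0 -> P = 0.
Proof.
move=> bP P0.
pose back : S -> T := subst (fun i => 'X_(rshift (2 * m - 2) (rev_ord i))).
have: back (evg m P) = 0 by rewrite P0 /back rmorph0.
rewrite /back /evg subst_comp => <-; rewrite -[LHS]subst_id; apply/esym.
apply: eq_subst_supp => mu i muP; rewrite /gens; case: split_ordP => [j ->|a ->] mui.
  by move: (bP _ muP j) mui; rewrite mul1n /reldeg split_lshift /relb subnn expn0 ltnS leqn0 => ->.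
rewrite ifF; last by lia.
by rewrite (flagvarE _ (ltn_ord a)) substX rev_ordK; congr ('X_(rshift _ _)); apply: val_inj.
Qed.

(** * From level k + 1 to level k *)

Section Step.
Variable k : nat.
Hypothesis k_lt : (k < m)%N.
Notation u' := (level F m k.+1).
Notation n' := ((m - k.+1).*2).

(* For [e = r] these are the values of the generators of level [k] modulo its first
   coordinate. Lowering [e] one step at a time only requires p-independence of the
   forms, and [e = 0] is the situation of level [k + 1]. *)
Definition gens0 e (i : 'I_s) : S :=
  match split i with
  | inl j => if (j.+1 <= n')%N then sympform q u' (m - k.+1) j.+1 else 0
  | inr a => if (k < a < m + m - k)%N then orbprod q u' (a - k.+1) ^+ (p ^ e)
             else flagvar F m a
  end.

(** For e = r this is the bound of level k, because [relb] grows by 1 from level k + 1 to level k;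
    for e = 0 it is the bound of level k + 1. *)
Definition xbounded0 e (P : T) := forall mu, mu \in msupp P -> forall j,
  (mu (lshift (m + m) j) <
    if (j.+1 <= n')%N then p ^ e * reldeg F k.+1 (lshift (m + m) j) else 1)%N.

Lemma ltn_k_2m : (k < m + m)%N. Proof. by lia. Qed.
Definition fidx : 'I_(m + m) := rev_ord (Ordinal ltn_k_2m).
Definition nidx : 'I_s := rshift (2 * m - 2) (Ordinal ltn_k_2m).

Lemma evg_mod (P : T) :
  subst1 fidx 0 (evg k P) = subst (gens0 r) (subst1 nidx 0 P).
Proof.
rewrite /evg /subst1 !subst_comp; apply: eq_subst => i.
pose v b := subst1 fidx 0 (level F m k b).
have v0 : v 0%N = 0 by rewrite /v /level addn0 (flagvarE _ ltn_k_2m) subst1X eqxx.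
have vS b : v b.+1 = u' b.
  by rewrite /v /level -addSnnS; apply: flagvar_free; rewrite neq_ltn ltnS leq_addr orbT.
rewrite -/(subst1 fidx 0); rewrite {1}/gens; case: split_ordP => [j ->|a ->].
  rewrite -(inj_eq val_inj) /= (_ : _ == _ = false) ?substX; last by have := ltn_ord j; lia.
  rewrite /gens0 split_lshift (_ : ((m - k).*2 - 2 = n')%N); last by lia.
  case: ifP => _; last by rewrite rmorph0.
  rewrite sympform_morph (_ : m - k = (m - k.+1).+1)%N; last by lia.
  rewrite (sympform_shift0 (qA _) q1 _ _ v0) /sympform; apply: eq_bigr => l _ /=.
  by rewrite -!/(v _) !vS.
rewrite (inj_eq (@rshift_inj _ _)) -val_eqE /=.
case: eqP => [ak|/eqP ak].
  rewrite rmorph0 ak subnn ifT; last by lia.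
  exact: v0.
rewrite substX /gens0 split_rshift; case: ifP => ka.
  rewrite ifT; last by lia.
  rewrite orbprod_morph /orbprod (_ : a - k = (a - k.+1).+1)%N; last by lia.
  rewrite (flagop_shift0 (qA _) q1 _ _ v0) -cardF -vS.
  by congr (_ ^+ _); apply: eq_flagop => b _; rewrite -vS.
rewrite ifF; last by lia.
by apply: flagvar_free.
Qed.

(** The weight recording the exponent of a single form variable, so that the calculus of [wtlt]
    bounds degrees in it. *)
Definition xdeg (j : 'I_(2 * m - 2)) (i : 'I_s) : nat := (i == lshift (m + m) j).

Lemma wt_xdeg j mu : wt (xdeg j) mu = mu (lshift (m + m) j).
Proof.
rewrite /wt (bigD1 (lshift (m + m) j)) //= big1 /xdeg ?eqxx ?muln1 ?addn0 // => i.
by move=> /negPf ->; rewrite muln0.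
Qed.

Lemma nvar_xdeg j b : wtlt (xdeg j) 1 (nvar F m b).
Proof.
rewrite /nvar; case: insubP => [i _ _|_]; last exact: wtlt0.
apply: wtlt_X; rewrite wt_xdeg mnm1E -val_eqE /=.
by have := ltn_ord j; case: eqP => //=; lia.
Qed.

Lemma wtlt1X (w : 'I_s -> nat) e (P : T) : wtlt w 1 P -> wtlt w 1 (P ^+ e).
Proof. by move=> /(wtltX (e := e)); rewrite muln0. Qed.

Lemma wtlt1M (w : 'I_s -> nat) n (P Q : T) : wtlt w n P -> wtlt w 1 Q -> wtlt w n (P * Q).
Proof. by move=> Pn Q1; rewrite -[n]addn0; apply: wtltM. Qed.

Lemma flagcoef_xdeg j a l : wtlt (xdeg j) 1 (flagcoef q (lnvar F m k.+1) a l).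
Proof.
elim: a l => [|a IH] l /=.
  case: (l == 0%N); last exact: wtlt0.
  by rewrite -mpolyX0; apply: wtlt_X; rewrite wt_xdeg mnm0E.
apply: wtltB; last first.
  by apply: wtlt1M; [apply: wtlt1X; apply: nvar_xdeg | apply: IH].
by case: l => [|l]; [apply: wtlt0 | apply: wtlt1X; apply: IH].
Qed.

Lemma subst1_xdeg j i0 (g : T) n P : wtlt (xdeg j) (xdeg j i0).+1 g ->
  wtlt (xdeg j) n P -> wtlt (xdeg j) n (subst1 i0 g P).
Proof.
move=> gj; apply: wtlt_subst => i; case: eqP => [-> //|_].
by apply: wtlt_X; rewrite wt_xdeg mnm1E.
Qed.

Lemma yidx_subproof : (k.+1 + n' < m + m)%N. Proof. by lia. Qed.
Definition yidx : 'I_s := rshift (2 * m - 2) (Ordinal yidx_subproof).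

(** At level k + 1 the coordinate y paired with the removed x is itself a generator, whereas
    [gens0 0] has its orbit product; this polynomial expresses the latter. *)
Definition formal_orbprod : T :=
  \sum_(l < n'.+1) flagcoef q (lnvar F m k.+1) n' l * 'X_yidx ^+ (q ^ l).

Lemma nvar_free i b : b != val i ->
  free_of (rshift (2 * m - 2) i) (nvar F m b).
Proof.
move=> bi; rewrite /nvar; case: insubP => [i0 _ i0b|_]; last exact: free_of0.
by apply: free_ofX; rewrite (inj_eq (@rshift_inj _ _)) -val_eqE i0b.
Qed.

Lemma flagcoef_free a l : (a <= n')%N ->
  free_of yidx (flagcoef q (lnvar F m k.+1) a l).
Proof.
move=> an; rewrite /free_of flagcoef_morph; apply: eq_flagcoef => b ba /=.
by apply: nvar_free; rewrite /= ltn_eqF // ltn_add2l (leq_trans ba).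
Qed.

Lemma formal_orbprod_inj : injective (subst1 yidx formal_orbprod).
Proof.
apply: subst1_inj; apply: leq_ltn_trans (size_uni_lin q1 _ _).
- exact: qexp_gt0.
- by move=> l _; apply: flagcoef_free.
- by rewrite flagcoef_top ?qA.
Qed.

Hypothesis independence_next :
  forall P : T, xbounded k.+1 1 P -> evg k.+1 P = 0 -> P = 0.

(** Substituting [formal_orbprod] for the variable of y turns [gens0 0] into the generators of level
    k + 1 and is injective. *)
Lemma independence0 P : xbounded0 0 P -> subst (gens0 0) P = 0 -> P = 0.
Proof.
move=> bP P0; apply: formal_orbprod_inj; rewrite rmorph0.
apply: independence_next.
  move=> mu muP j; rewrite -wt_xdeg mul1n; move: mu muP.
  apply: (@subst1_xdeg j).
    rewrite /formal_orbprod (_ : xdeg j yidx = 0%N); last first.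
      by rewrite /xdeg -val_eqE /=; have := ltn_ord j; case: eqP => //=; lia.
    apply: wtlt_sum => l _; apply: wtlt1M; first exact: flagcoef_xdeg.
    by apply: wtlt1X; rewrite /yidx -nvarE; apply: nvar_xdeg.
  move=> mu /bP /(_ j); rewrite wt_xdeg; case: ifP => [_|jn]; first by rewrite expn0 mul1n.
  by rewrite ltnS leqn0 => /eqP ->; apply: reldeg_gt0.
rewrite -P0 /evg /subst1 subst_comp; apply: eq_subst_supp => mu i muP mui.
case: eqP => [->|/eqP iy].
  rewrite /gens0 split_rshift /= ifT; last by lia.
  rewrite /formal_orbprod -/(evg k.+1 _) rmorph_sum /= expn0 expr1.
  rewrite (_ : k.+1 + n' - k.+1 = n')%N; last by lia.
  rewrite {1}/orbprod flagop_expand ?qA //; apply: eq_bigr => l _.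
  rewrite rmorphM rmorphXn /= (evg_flagcoef p_pr cardF) //; congr (_ * _ ^+ _).
  rewrite /yidx -nvarE evg_nvar_out //; lia.
rewrite substX /gens /gens0; case: split_ordP iy mui => [j -> _ muj | a ->].
  have := bP _ muP j; case: (leqP j.+1 n') => jn; last first.
    by move: muj; case: (mu _).
  (* The two forms of largest index here are no generators at level k + 1, but the bound keeps their
     variables out of [P]. *)
  rewrite expn0 mul1n /reldeg split_lshift; case: ifP => // jn2.
  rewrite /relb (_ : (_ - _)./2 = 0)%N; last by lia.
  by rewrite expn0; move: muj; case: (mu _).
rewrite (inj_eq (@rshift_inj _ _)) -val_eqE /= => ay _.
rewrite expn0 expr1 (_ : (k < a < m + m - k) = (k < a < m + m - k.+1))%N //; lia.
Qed.

Definition vidx a (h : (a < m + m)%N) : 'I_(m + m) := rev_ord (Ordinal h).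

Lemma mderiv_flagvar a b (hb : (b < m + m)%N) :
  (flagvar F m a)^`M(vidx hb) = (a == b)%:R.
Proof.
have [ha|ha] := ltnP a (m + m); last first.
  by rewrite /flagvar insubF ?mderiv0 ?ltnNge ?ha // gtn_eqF // (leq_trans hb).
rewrite (flagvarE _ ha) mderivX mnm1E (inj_eq rev_ord_inj) -val_eqE /=.
case: eqP => [ab|_]; last by rewrite scale0r.
rewrite scale1r (_ : rev_ord _ = vidx hb); last by congr rev_ord; apply: val_inj.
by rewrite -[X in (X - _)%MM]add0m addmK mpolyX0.
Qed.

Lemma mderiv_exp_pS (i : 'I_(m + m)) (f : S) e : (f ^+ (p ^ e.+1))^`M(i) = 0.
Proof. by rewrite expnSr exprM mderiv_const. Qed.

Lemma mderiv_exp_qS (i : 'I_(m + m)) (f : S) e : (f ^+ (q ^ e.+1))^`M(i) = 0.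
Proof.
by rewrite cardF -expnM; case: r r_gt0 => // r' _; rewrite mulSn addSn mderiv_exp_pS.
Qed.

Lemma mderiv_sympform c i (hc : (k.+1 + c < m + m)%N) : (c < n')%N ->
  (sympform q u' (m - k.+1) i.+1)^`M(vidx hc) =
  (if (c < m - k.+1)%N then 1 else -1) * u' (n'.-1 - c)%N ^+ (q ^ i.+1).
Proof.
move=> cn; rewrite /sympform raddf_sum /=.
have D l : (u' (n'.-1 - l)%N ^+ (q ^ i.+1) * u' l
            - u' (n'.-1 - l)%N * u' l ^+ (q ^ i.+1))^`M(vidx hc)
    = u' (n'.-1 - l)%N ^+ (q ^ i.+1) * (l == c)%:R
      - (n'.-1 - l == c)%N%:R * u' l ^+ (q ^ i.+1).
  rewrite mderivB !mderivM !mderiv_exp_qS mul0r mulr0 add0r addr0.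
  by rewrite !mderiv_flagvar !eqn_add2l.
under eq_bigr do rewrite D; case: ltnP => cm.
  rewrite (bigD1 (Ordinal cm)) //= eqxx mulr1 (_ : (_ == c) = false); last by lia.
  rewrite mul0r subr0 mul1r big1 ?addr0 // => l /negPf lc.
  have lm := ltn_ord l; rewrite -val_eqE /= in lc.
  by rewrite lc (_ : (_ == c) = false) ?mulr0 ?mul0r ?subr0 //; lia.
have hl : (n'.-1 - c < m - k.+1)%N by lia.
rewrite (bigD1 (Ordinal hl)) //= (_ : (n'.-1 - (n'.-1 - c) == c)%N = true); last by lia.
rewrite (_ : (n'.-1 - c == c)%N = false); last by lia.
rewrite mulr0 sub0r mulNr big1 ?addr0 // => l /negPf lc.
have lm := ltn_ord l; rewrite -val_eqE /= in lc.
rewrite (_ : (n'.-1 - l == c)%N = false); last by lia.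
by rewrite (_ : (nat_of_ord l == c) = false) ?mulr0 ?mul0r ?subr0 //; lia.
Qed.

(* The products are p-th powers, so the derivative along each coordinate of level
   [k + 1] only involves the forms, whose Jacobian is a Moore matrix up to signs. *)
Lemma evg0_deriv e P : subst (gens0 e.+1) P = 0 ->
  forall j : 'I_(2 * m - 2), (j.+1 <= n')%N ->
  subst (gens0 e.+1) P^`M(lshift (m + m) j) = 0.
Proof.
move=> P0; pose g l := if insub l is Some j then
  subst (gens0 e.+1) P^`M(lshift (m + m) (j : 'I_(2 * m - 2))) else 0.
have gE (j : 'I_(2 * m - 2)) : subst (gens0 e.+1) P^`M(lshift (m + m) j) = g j.
  by rewrite /g valK.
move=> j jn; rewrite gE.
(* The derivatives carry exponents q^(i+1); passing to q-th powers gives a Moore matrix with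
   exponents q^i. *)
pose w b := u' b ^+ q.
have qS := qA (m + m).
apply: (@moore_regular q _ w n' g) => // [a an|c cn].
  have wE b : w b = u' b ^+ (p ^ r) := congr1 (fun e => u' b ^+ e) cardF.
  have -> : orbprod q w a = orbprod q u' a ^+ (p ^ r).
    rewrite /orbprod (flagop_frob _ (pchar_mpoly _)) wE.
    by apply: eq_flagop => b _; apply: wE.
  by apply: expf_neq0; apply: orbprod_neq0; lia.
(* Differentiating along the partner of coordinate c brings out the powers of [u' c]. *)
pose c' := (n'.-1 - c)%N; have hc : (k.+1 + c' < m + m)%N by rewrite /c'; lia.
have c'n : (c' < n')%N by rewrite /c'; lia.
have := congr1 (mderiv (vidx hc)) P0; rewrite mderiv0 chain_rule big_split_ord /=.
rewrite [X in _ + X]big1 ?addr0 => [|a _]; last first.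
  rewrite {2}/gens0 split_rshift; case: ifP => ka; first by rewrite mderiv_exp_pS mulr0.
  rewrite mderiv_flagvar (_ : _ == _ = false) ?mulr0 //; lia.
move=> sum0; pose sg : S := (if (c' < m - k.+1)%N then 1 else -1).
have sg_neq0 : sg != 0 by rewrite /sg; case: ifP; rewrite ?oppr_eq0 oner_neq0.
apply: (mulfI sg_neq0); rewrite mulr0 -[RHS]sum0 mulr_sumr.
have n2 : (n' <= 2 * m - 2)%N by lia.
rewrite -(big_mkord xpredT (fun i => sg * (g i * w c ^+ (q ^ i)))).
rewrite (big_nat_widen _ _ _ _ _ n2) big_mkord big_mkcond /=.
apply: eq_bigr => i _ /=; rewrite gE /gens0 split_lshift; case: ifP => _; last first.
  by rewrite mderiv0 mulr0.
rewrite mderiv_sympform // -/sg mulrCA; congr (_ * (_ * _)).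
by rewrite /w -exprM -expnS /c' (_ : n'.-1 - (n'.-1 - c) = c)%N //; lia.
Qed.

Lemma xbounded0_deriv e P j : xbounded0 e P -> xbounded0 e P^`M(j).
Proof.
move=> bP mu muP j'; apply: leq_ltn_trans (bP (mu + U_(j))%MM _ j').
  by rewrite mnmDE leq_addr.
move: muP; rewrite !mcoeff_msupp mcoeff_deriv; apply: contra_neq => ->.
by rewrite mul0rn.
Qed.

Lemma msize_deriv (P : T) j : P != 0 -> (msize P^`M(j) < msize P)%N.
Proof.
move=> nzP; rewrite -[msize P]prednK ?lt0n ?msize_poly_eq0 // ltnS.
rewrite {1}msizeE; apply/bigmax_leqP_seq => mu muP _.
have : (mu + U_(j))%MM \in msupp P.
  move: muP; rewrite !mcoeff_msupp mcoeff_deriv; apply: contra_neq => ->.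
  by rewrite mul0rn.
by move=> /msize_mdeg_lt; rewrite mdegD mdeg1; lia.
Qed.

Definition frobv (i : 'I_(m + m)) : nat :=
  if (k < m + m - i.+1 < m + m - k)%N then p else 1%N.

Lemma powsub_flagvar a : powsub frobv (flagvar F m a) =
  if (k < a < m + m - k)%N then flagvar F m a ^+ p else flagvar F m a.
Proof.
have [ha|ha] := ltnP a (m + m); last first.
  rewrite /flagvar insubF ?rmorph0 ?ltnNge ?ha //.
  by case: ifP => //; rewrite expr0n; case: (p) (prime_gt0 p_pr).
rewrite (flagvarE _ ha) /powsub substX /frobv /=.
rewrite (_ : m + m - (m + m - a.+1).+1 = a)%N; last by lia.
by case: ifP.
Qed.

Lemma powsub_level b : (b <= n')%N -> powsub frobv (u' b) = u' b ^+ p.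
Proof. by move=> bn; rewrite powsub_flagvar ifT //; lia. Qed.

Definition frobx (i : 'I_s) : nat :=
  match split i with inl _ => p | inr _ => 1%N end.

(** Raising the coordinates to p-th powers raises the forms and orbit products to p-th powers. For
    the forms this is matched by [frobx], for the orbit products by passing from e to e + 1. *)
Lemma gens0_powsub e P :
  subst (gens0 e.+1) (powsub frobx P) = powsub frobv (subst (gens0 e) P).
Proof.
rewrite /powsub !subst_comp; apply: eq_subst => i.
rewrite rmorphXn /= substX -/(powsub frobv _) /frobx /gens0.
case: split_ordP => [j _|a _]; rewrite ?expr1.
  case: ifP => _; last by rewrite rmorph0 expr0n; case: (p) (prime_gt0 p_pr).
  rewrite sympform_morph /= -(pFrobenius_autE (pchar_mpoly _)) sympform_morph.
  rewrite /sympform; apply: eq_bigr => l _ /=; have ln := ltn_ord l.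
  by rewrite !pFrobenius_autE !powsub_level //; lia.
case: ifP => ka; last by rewrite powsub_flagvar ka.
rewrite rmorphXn /= orbprod_morph expnS exprM; congr (_ ^+ _).
rewrite -(pFrobenius_autE (pchar_mpoly _)) orbprod_morph /orbprod /=.
rewrite pFrobenius_autE powsub_level; last by lia.
by apply: eq_flagop => b ba /=; rewrite pFrobenius_autE powsub_level //; lia.
Qed.

(** Induction on e, then on the size of [P]. The derivatives along the form variables are smaller
    relations, hence zero, so [P] involves these variables only through p-th powers and comes from a
    relation for the preceding e. *)
Lemma independence_frob e P : xbounded0 e P -> subst (gens0 e) P = 0 -> P = 0.
Proof.
elim: e P => [|e IHe] P; first exact: independence0.
have [n] := ubnP (msize P); elim: n P => // n IHn P; rewrite ltnS => szP bP P0.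
have [//|nzP] := eqVneq P 0.
have dP (j : 'I_(2 * m - 2)) : (j.+1 <= n')%N -> P^`M(lshift (m + m) j) = 0.
  move=> jn; apply: IHn; [|exact: xbounded0_deriv|exact: evg0_deriv].
  exact: leq_trans (msize_deriv _ nzP) szP.
have p_gt0 := prime_gt0 p_pr.
have [|Q PQ suppQ] := @powsub_preim _ _ frobx P.
  move=> mu i muP; rewrite /frobx; case: split_ordP => [j ->|a _]; last exact: dvd1n.
  case: (leqP j.+1 n') => jn; last first.
    by have := bP _ muP j; rewrite ifN -?ltnNge // ltnS leqn0 => /eqP ->.
  case mu_j : (mu (lshift (m + m) j)) => [//|d].
  have := congr1 (mcoeff (mu - U_(lshift (m + m) j))%MM) (dP j jn).
  rewrite mcoeff_deriv submK; last by rewrite lep1mP mu_j.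
  rewrite mcoeff0 mnmBE mu_j mnm1E eqxx subn1 /= => /eqP.
  rewrite -mulr_natr mulf_eq0 mcoeff_eq0 muP /=.
  by rewrite -(dvdn_pcharf pF).
rewrite PQ (IHe Q) ?rmorph0 //.
  move=> nu nuQ j; have := bP _ (suppQ _ nuQ) j.
  rewrite mnmE /frobx split_lshift; case: ifP => _; last by case: (nu _) => // d; nia.
  by rewrite expnSr mulnAC ltn_pmul2r.
apply: (@powsub_inj _ _ frobv); last by rewrite -gens0_powsub -PQ P0 rmorph0.
by move=> i; rewrite /frobv; case: ifP.
Qed.

Lemma independence_mod (P : T) : xbounded k 1 P -> subst1 fidx 0 (evg k P) = 0 ->
  subst1 nidx 0 P = 0.
Proof.
move=> bP P0; apply: (@independence_frob r); last by rewrite -evg_mod P0.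
move=> mu muP j; rewrite -wt_xdeg; move: mu muP; apply: (@subst1_xdeg j).
  exact: wtlt0.
move=> mu muP; rewrite wt_xdeg; have := bP _ muP j.
rewrite mul1n /reldeg split_lshift /relb; case: ifP => jn.
  rewrite -cardF -expnS (_ : ((m - k).*2 - j.+1)./2 = ((m - k.+1).*2 - j.+1)./2.+1)%N //; lia.
by rewrite (_ : ((m - k).*2 - j.+1)./2 = 0)%N //; lia.
Qed.

Lemma evg_nidx : evg k ('X_nidx : T) = flagvar F m k.
Proof.
rewrite /evg substX /gens split_rshift /= ifT; last by lia.
by rewrite subnn /orbprod /= /level addn0.
Qed.

Lemma xbounded_nidx (P : T) : xbounded k 1 P -> subst1 nidx 0 P = 0 ->
  exists2 Q, P = 'X_nidx * Q & xbounded k 1 Q.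
Proof.
move=> bP P0; have [Q] := subst1_factor nidx 0 P; rewrite P0 !subr0 => PQ.
exists Q => // mu muQ j.
have : (mu + U_(nidx))%MM \in msupp P.
  by rewrite PQ mulrC (perm_mem (msuppMX _ _)) addmC; apply/mapP; exists mu.
move=> /bP /(_ j); apply: leq_ltn_trans.
by rewrite mnmDE leq_addr.
Qed.

(** A relation vanishes modulo the variable of x, hence is divisible by it; the quotient is a
    smaller relation because x is not a zero divisor. *)
Lemma independence_step (P : T) : xbounded k 1 P -> evg k P = 0 -> P = 0.
Proof.
have [n] := ubnP (msize P); elim: n P => // n IHn P; rewrite ltnS => szP bP P0.
have [//|nzP] := eqVneq P 0.
have [|Q PQ bQ] := xbounded_nidx bP; first by apply: independence_mod; rewrite ?P0 ?rmorph0.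
rewrite PQ (IHn Q) ?mulr0 //.
  apply: leq_trans szP; have nzQ : Q != 0 by apply: contraNneq nzP => Q0; rewrite PQ Q0 mulr0.
  have nzX : ('X_nidx : T) != 0 by rewrite -msize_poly_eq0 msizeX.
  by rewrite PQ msizeM // msizeX mdeg1.
move/eqP: P0; rewrite PQ rmorphM /= evg_nidx mulf_eq0 => /orP [|/eqP //].
by rewrite (negPf (flagvar_neq0 _)) //; lia.
Qed.

End Step.

Theorem independence k (P : T) : (k <= m)%N -> xbounded k 1 P -> evg k P = 0 -> P = 0.
Proof.
move=> km; move: P; rewrite -(subKn km); move: (m - k)%N (leq_subr k m) => d.
elim: d => [|d IH] dm P; first by rewrite subn0; apply: independence_base.
have mdS : (m - d.+1).+1 = (m - d)%N by lia.
apply: independence_step; first by lia.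
by rewrite mdS; apply: IH; apply: ltnW.
Qed.

Lemma evg_divides k (P : T) (h : S) : (k < m)%N -> xbounded k 1 P ->
  evg k P = flagvar F m k * h -> exists2 Q, h = evg k Q & xbounded k 1 Q.
Proof.
move=> km bP Ph.
have [|Q PQ bQ] := xbounded_nidx (k_lt := km) bP.
  apply: independence_mod => //; first by move=> Q; apply: independence.
  by rewrite Ph rmorphM /= (flagvarE _ (ltn_k_2m km)) subst1X eqxx mul0r.
exists Q => //; apply: (mulfI (@flagvar_neq0 k _)); first by lia.
by rewrite -Ph PQ rmorphM /= evg_nidx.
Qed.

End Independence.

(** * Unitriangular symplectic matrices *)

Section SymplecticMatrices.
Variables (F : finFieldType) (m : nat).
Notation q := #|F|.
Notation S := {mpoly F[m + m]}.
Implicit Types (i j : 'I_(m + m)).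

Definition sgn i : F := if (i < m)%N then 1 else -1.

Lemma sgn_rev i : sgn (rev_ord i) = - sgn i.
Proof.
rewrite /sgn /=; have im := ltn_ord i.
rewrite (_ : (m + m - i.+1 < m) = ~~ (i < m))%N; last by lia.
by case: (i < m)%N; rewrite /= ?opprK.
Qed.

Lemma sgn_sq i : sgn i * sgn i = 1.
Proof. by rewrite /sgn; case: ifP; rewrite ?mulr1 // mulrNN mulr1. Qed.

Lemma sympJE i j : sympJ F m i j = if j == rev_ord i then sgn i else 0.
Proof.
rewrite /sympJ /sgn -val_eqE.
case: (split_ordP i) => i' ->; case: (split_ordP j) => j' -> /=;
  have im := ltn_ord i'; have jm := ltn_ord j';
  rewrite ?block_mxEul ?block_mxEur ?block_mxEdl ?block_mxEdr !mxE ?im.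
- by rewrite ifF //; lia.
- rewrite -val_eqE /= (_ : (_ == m + m - _)%N = (j' == m - i'.+1 :> nat)%N); last by lia.
  by case: eqP.
- rewrite -val_eqE /=.
  rewrite (_ : (_ == m + m - _)%N = (j' == m - i'.+1 :> nat)%N); last by lia.
  by case: eqP; rewrite ?oppr0.
- by rewrite ifF //; lia.
Qed.

Lemma delta_sympJ i j : delta_mx j i *m sympJ F m = sgn i *: delta_mx j (rev_ord i).
Proof.
apply/matrixP => a b; rewrite !mxE (bigD1 i) //= big1 ?addr0 => [|l li].
  rewrite sympJE mxE eqxx andbT; case: eqP => _; rewrite ?mul0r ?mulr0 //= mul1r.
  by case: eqP; rewrite ?mulr1 ?mulr0.
by rewrite [X in X * _]mxE (negPf li) andbF mul0r.
Qed.

Lemma sympJ_delta i j : sympJ F m *m delta_mx i j = - sgn i *: delta_mx (rev_ord i) j.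
Proof.
apply/matrixP => a b; rewrite !mxE (bigD1 i) //= big1 ?addr0 => [|l li].
  rewrite sympJE mxE eqxx /= -(inj_eq rev_ord_inj) rev_ordK.
  case: eqP => [<-|/eqP ai]; first by rewrite eqxx sgn_rev.
  by rewrite [a == _]eq_sym (negPf ai) mul0r mulr0.
by rewrite [X in _ * X]mxE (negPf li) mulr0.
Qed.

(* The infinitesimal symplectic matrix of the root subgroup through position [(i, j)]. *)
Definition rootmx i j : 'M[F]_(m + m) :=
  delta_mx i j
  - (if j == rev_ord i then 0 else sgn i * sgn j) *: delta_mx (rev_ord j) (rev_ord i).

Lemma rootmx_tr i j : (rootmx i j)^T *m sympJ F m = - (sympJ F m *m rootmx i j).
Proof.
rewrite /rootmx linearB linearZ /= !trmx_delta mulmxBl mulmxBr -scalemxAl -scalemxAr.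
rewrite !delta_sympJ !sympJ_delta !rev_ordK !sgn_rev !scalerA.
case: eqP => [->|_]; first by rewrite !mul0r !scale0r !subr0 scaleNr opprK.
have e : sgn i * sgn j * sgn j = sgn i by rewrite -mulrA sgn_sq mulr1.
by rewrite mulrN opprK e !scaleNr opprB.
Qed.

Lemma neq_rev i : i != rev_ord i.
Proof. by rewrite -val_eqE /=; apply/eqP; have := ltn_ord i; lia. Qed.

Lemma rootmx_sq i j : i != j -> rootmx i j *m rootmx i j = 0.
Proof.
move=> ij; rewrite /rootmx mulmxBl !mulmxBr -!scalemxAl -!scalemxAr !mul_delta_mx_cond.
rewrite (inj_eq rev_ord_inj) (eq_sym j) (negPf ij) (negPf (neq_rev j)).
rewrite (eq_sym _ i) (negPf (neq_rev i)) !mulr0n !scaler0 !subr0 //.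
Qed.

(** For i != j the root matrix has square zero, so this is its exponential. *)
Definition rootelt i j (c : F) : 'M[F]_(m + m) := 1%:M + c *: rootmx i j.

Lemma rootelt_USp i j c : (i < j)%N -> USp (rootelt i j c).
Proof.
move=> ij; have nij : i != j by rewrite neq_ltn ij.
have sq := rootmx_sq nij.
split.
- split.
    have : rootelt i j c *m (1%:M - c *: rootmx i j) = 1%:M.
      rewrite /rootelt mulmxDl mul1mx mulmxBr mulmx1 -scalemxAl -scalemxAr sq !scaler0.
      by rewrite subr0 subrK.
    by case/mulmx1_unit.
  have -> : (rootelt i j c)^T = 1%:M + c *: (rootmx i j)^T.
    by rewrite /rootelt linearD linearZ /= trmx1.
  rewrite /rootelt mulmxDl mul1mx -scalemxAl rootmx_tr.
  move: (rootmx i j) sq => D sq.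
  rewrite mulmxDl !mulmxDr !mulmx1 -!scalemxAl -!scalemxAr !mulNmx -mulmxA sq mulmx0.
  by rewrite oppr0 !scaler0 addr0 scalerN addrK.
- move=> a b ba; rewrite !mxE -!val_eqE /=.
  have ai : ((a == i :> nat) && (b == j :> nat))%N = false by apply/negP => /andP [/eqP] *; lia.
  have aj : ((a == m + m - j.+1 :> nat) && (b == m + m - i.+1 :> nat))%N = false.
    by apply/negP => /andP [/eqP e1 /eqP e2]; have := ltn_ord j; lia.
  by rewrite ai aj gtn_eqF // mulr0 subr0 mulr0 addr0.
exists 2%N; rewrite /rootelt addrC addKr expr2 -mulmxE -scalemxAl -scalemxAr sq.
by rewrite !scaler0.
Qed.

Lemma USp_diag A i : @USp F m A -> A i i = 1.
Proof.
move=> [_ upA [k nilA]]; pose B := A - 1%:M.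
have upB : upper_triangular B.
  by move=> a b ba; rewrite !mxE upA // -val_eqE /= gtn_eqF // subr0.
have powB e : upper_triangular (B ^+ e) /\ (B ^+ e) i i = B i i ^+ e.
  elim: e => [|e [upBe IH]].
    by rewrite !expr0; split=> [a b ba|]; rewrite !mxE ?eqxx // -val_eqE /= gtn_eqF.
  rewrite !exprS -mulmxE; split=> [a b ba|].
    rewrite mxE big1 // => l _; have [la|al] := ltnP l a; first by rewrite upB ?mul0r.
    by rewrite upBe ?mulr0 // (leq_trans ba).
  rewrite mxE (bigD1 i) //= big1 ?addr0 ?IH // => l li.
  have [l_i|i_l] := ltnP l i; first by rewrite upB ?mul0r.
  by rewrite upBe ?mulr0 // ltn_neqAle i_l andbT eq_sym.
have /eqP := (powB k).2; rewrite /B nilA mxE eq_sym expf_eq0 => /andP [_].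
by rewrite !mxE eqxx subr_eq0 => /eqP.
Qed.

Definition matsub (A : 'M[F]_(m + m)) : S -> S :=
  subst (fun i => \sum_j (A i j)%:MP * 'X_j).
HB.instance Definition _ A := GRing.RMorphism.on (matsub A).

Lemma linformE (phi : 'rV[F]_(m + m)) : linform phi = \sum_j (phi 0 j)%:MP * 'X_j.
Proof. by apply: eq_bigr => j _; rewrite mul_mpolyC. Qed.

Lemma mpoly_actE p A : mpoly_act p A = matsub A p.
Proof.
rewrite /mpoly_act /matsub /subst; congr (_ \mPo _); apply: eq_mktuple => i.
by rewrite linformE -rowE; apply: eq_bigr => j _; rewrite mxE.
Qed.

Lemma linform_delta i : linform (delta_mx 0 i : 'rV[F]_(m + m)) = 'X_i.
Proof.
rewrite /linform (bigD1 i) //= mxE !eqxx scale1r big1 ?addr0 // => j ji.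
by rewrite mxE (negPf ji) andbF scale0r.
Qed.

Notation fv := (flagvar F m).

Lemma flagvar_ord i : fv (rev_ord i) = 'X_i.
Proof.
rewrite (flagvarE _ (ltn_ord _)); congr 'X_ _.
by apply: rev_ord_inj; rewrite rev_ordK; apply: val_inj.
Qed.

Lemma yE (j : 'I_m) : y F j = fv (m.*2.-1 - j)%N.
Proof.
rewrite /y /ydual linform_delta -flagvar_ord; congr fv; rewrite /=; lia.
Qed.

Lemma xE (j : 'I_m) : x F j = fv j.
Proof.
rewrite /x /xdual linform_delta -flagvar_ord; congr fv; rewrite /=.
by have := ltn_ord j; lia.
Qed.

Lemma xiE (i : nat) : xi F m i = sympform q fv m i.
Proof. by apply: eq_bigr => j _; rewrite yE xE. Qed.

Lemma sympform_J (i : nat) : sympform q fv m i =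
  \sum_a \sum_b (sympJ F m a b)%:MP * ('X_a ^+ (q ^ i) * 'X_b).
Proof.
have inner a : \sum_b (sympJ F m a b)%:MP * ('X_a ^+ (q ^ i) * 'X_b)
    = (sgn a)%:MP * ('X_a ^+ (q ^ i) * 'X_(rev_ord a)) :> S.
  rewrite (bigD1 (rev_ord a)) //= sympJE eqxx big1 ?addr0 // => b ba.
  by rewrite sympJE (negPf ba) mpolyC0 mul0r.
under eq_bigr do rewrite inner; rewrite big_split_ord /= /sympform.
rewrite [X in _ + X](reindex_inj rev_ord_inj) -big_split; apply: eq_bigr => j _ /=.
have jm := ltn_ord j.
rewrite -!flagvar_ord /sgn /= jm ltnNge leq_addr /= mpolyC1 mul1r mpolyCN mulN1r.
rewrite (_ : m + m - (m + m - j.+1).+1 = j)%N; last by lia.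
rewrite (_ : m + m - (m + (m - j.+1)).+1 = j)%N; last by lia.
rewrite (_ : m + m - j.+1 = m.*2.-1 - j)%N; last by lia.
by congr (_ - _); rewrite mulrC.
Qed.

Variables (p r : nat) (p_pr : prime p) (cardF : q = (p ^ r)%N).
Let q1 : (1 < q)%N := @q_gt1 F.
Let qA n : [pchar {mpoly F[n]}].-nat q := pnat_qmpoly p_pr cardF n.

Lemma expq_const (c : F) (i n : nat) : (c%:MP : {mpoly F[n]}) ^+ (q ^ i) = c%:MP.
Proof.
elim: i => [|i IH] /=; first by rewrite expr1.
by rewrite expnSr exprM IH -rmorphXn /= expf_card.
Qed.

(** By [sympform_J] the form pairs the Frobenius twist of the generic point with the point itself.
    The twist fixes the entries of [A], so A^T J A = J applies. *)
Lemma sympform_inv A (i : nat) : @USp F m A ->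
  matsub A (sympform q fv m i) = sympform q fv m i.
Proof.
move=> [[_ symA] _ _]; rewrite sympform_J rmorph_sum /=.
have term a b : matsub A ((sympJ F m a b)%:MP * ('X_a ^+ (q ^ i) * 'X_b)) =
  \sum_j \sum_l (A a j * sympJ F m a b * A b l)%:MP * ('X_j ^+ (q ^ i) * 'X_l).
  rewrite !rmorphM rmorphXn /= /matsub substC !substX.
  rewrite (expq_sum (qA _) q1) mulr_suml mulr_sumr; apply: eq_bigr => j _.
  rewrite exprMn expq_const !mulr_sumr; apply: eq_bigr => l _.
  by rewrite !mpolyCM; ring.
under eq_bigr => a _ do rewrite rmorph_sum /=.
under eq_bigr => a _ do under eq_bigr => b _ do rewrite term.
under eq_bigr => a _ do rewrite exchange_big /=.
rewrite exchange_big /=; apply: eq_bigr => j _.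
under eq_bigr => a _ do rewrite exchange_big /=.
rewrite exchange_big /=; apply: eq_bigr => l _.
rewrite -[in RHS]symA mxE (raddf_sum (@mpolyC _ _)) mulr_suml exchange_big /=.
by apply: eq_bigr => b _; rewrite mxE mulr_suml (raddf_sum (@mpolyC _ _)) mulr_suml;
  apply: eq_bigr => a _; rewrite [A^T _ _]mxE.
Qed.

(** Since [flagvar] reverses the order of the coordinates, an upper triangular matrix adds to each
    only preceding ones, with constants of the finite field as coefficients. *)
Lemma matsub_flagvar A b : @USp F m A ->
  exists2 c : nat -> S, (forall d, c d ^+ q = c d) &
    matsub A (fv b) = fv b + \sum_(d < b) c d * fv d.
Proof.
move=> USpA; have [hb|hb] := ltnP b (m + m); last first.
  exists (fun=> 0) => [d|]; first by rewrite expr0n eqn0Ngt (ltnW q1).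
  by rewrite /flagvar insubF ?ltnNge ?hb // rmorph0 add0r big1 // => d _; rewrite mul0r.
set i := Ordinal hb.
exists (fun d => if insub d is Some d' then (A (rev_ord i) (rev_ord d'))%:MP else 0).
  move=> d; case: insub => [d'|]; first by rewrite -[q]expn1 expq_const.
  by rewrite expr0n eqn0Ngt (ltnW q1).
rewrite (flagvarE _ hb) /matsub substX (reindex_inj rev_ord_inj) /=.
rewrite (bigD1 i) //= USp_diag // mpolyC1 mul1r; congr (_ + _).
rewrite (big_ord_widen_cond (m + m) xpredT (fun d => (if insub d is Some d' then
  (A (rev_ord i) (rev_ord d'))%:MP else 0) * fv d)) 1?ltnW //.
rewrite [LHS](bigID (fun d : 'I_(m + m) => (d < b)%N)) /= [X in _ + X]big1 ?addr0.
  apply: eq_big => [d|d /andP [_ db]].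
    by rewrite -val_eqE /= andbC andb_idr // => /ltn_eqF ->.
  by rewrite valK -flagvar_ord rev_ordK.
move=> d /andP [di db]; case: USpA => _ upA _; rewrite upA ?mpolyC0 ?mul0r //=.
by rewrite -val_eqE /= in di; have := ltn_ord d; lia.
Qed.

Lemma orbprod_inv A a : @USp F m A ->
  matsub A (orbprod q fv a) = orbprod q fv a.
Proof.
move=> USpA; rewrite orbprod_morph; apply: (orbprod_unitriangular (qA _) q1) => b.
exact: matsub_flagvar.
Qed.

End SymplecticMatrices.

(** * Generation of the invariants *)

Section OneVariableInvariants.
Variable F : finFieldType.
Notation q := #|F|.

(** Homogenization, in the fraction field, of the factorization of T^q - T over the finite field. *)
Lemma prod_sub_scaled (A : idomainType) (f : {rmorphism F -> A}) (X Y : A) :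
  \prod_(c : F) (X - f c * Y) = X ^+ q - Y ^+ q.-1 * X.
Proof.
have [->|nzY] := eqVneq Y 0.
  under eq_bigr do rewrite mulr0 subr0; rewrite prodr_const expr0n -subn1 subn_eq0.
  by rewrite leqNgt q_gt1 mul0r subr0.
apply/eqP; rewrite -tofrac_eq; apply/eqP.
have nzgY : tofrac Y != 0 by rewrite tofrac_eq0.
have := congr1 (fun P => (map_poly (@tofrac A \o f) P).[tofrac X / tofrac Y]) (finField_genPoly F).
rewrite rmorphB rmorphXn /= map_polyX hornerD hornerN hornerXn hornerX => genP.
rewrite rmorph_prod rmorphB rmorphM !rmorphXn /=.
transitivity (tofrac Y ^+ q * ((tofrac X / tofrac Y) ^+ q - tofrac X / tofrac Y)); last first.
  rewrite mulrBr expr_div_n mulrCA divff ?expf_neq0 // mulr1; congr (_ - _).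
  by rewrite -{1}(prednK (q_gt0 F)) exprSr -mulrA [tofrac Y * _]mulrCA divff ?mulr1.
rewrite genP rmorph_prod horner_prod /= .
have -> : tofrac Y ^+ q = \prod_(c : F) tofrac Y by rewrite prodr_const.
rewrite -big_split; apply: eq_bigr => c _ /=.
rewrite map_polyXsubC hornerXsubC rmorphB rmorphM /=.
by rewrite mulrBr mulrCA divff // mulr1 [tofrac Y * _]mulrC.
Qed.

Section Translations.
Variables (n : nat) (i j : 'I_n).
Hypothesis ij : i != j.
Notation A := {mpoly F[n]}.

Definition additive_poly : A := 'X_i ^+ q - 'X_j ^+ q.-1 * 'X_i.

Lemma additive_polyE :
  additive_poly = \prod_(c : F) ('X_i - c%:MP * 'X_j).
Proof. by rewrite (prod_sub_scaled (@mpolyC n F)). Qed.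

Lemma vanish_multiples (L : seq F) (g : A) : uniq L ->
  (forall c, c \in L -> subst1 i (c%:MP * 'X_j) g = 0) ->
  exists h, g = \prod_(c <- L) ('X_i - c%:MP * 'X_j) * h.
Proof.
have ji : (j == i) = false by rewrite eq_sym (negPf ij).
elim: L => [_ _|c L IH /= /andP [cL uL] van]; first by exists g; rewrite big_nil mul1r.
have [|h gh] := IH uL; first by move=> d dL; apply: van; rewrite inE dL orbT.
have h0 : subst1 i (c%:MP * 'X_j) h = 0.
  have /eqP := van c (mem_head _ _).
  rewrite gh rmorphM rmorph_prod mulf_eq0 => /orP [|/eqP //] /=.
  rewrite prodf_seq_eq0 => /hasP [d dL] /=.
  rewrite rmorphB rmorphM /= !subst1X subst1C eqxx ji -mulrBl -mpolyCB mulf_eq0.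
  rewrite mpolyC_eq0 subr_eq0 => /orP [/eqP cd|]; first by rewrite cd dL in cL.
  by rewrite -msize_poly_eq0 msizeX.
have [h' hh'] := subst1_factor i (c%:MP * 'X_j) h.
exists h'; rewrite gh big_cons -[in LHS](subr0 h) -h0 hh'; ring.
Qed.

Lemma size_uni_additive (l c g : A) :
  l != 0 -> free_of i l -> free_of i c -> free_of i g ->
  (1 < size (uni i (l * ('X_i ^+ q - c * 'X_i) + g)))%N.
Proof.
move=> nzl fl fc fg; apply: (@leq_trans q.+1); first by rewrite ltnS q_gt0.
rewrite ltnNge; apply: contra nzl => /leq_sizeP /(_ q (leqnn _)).
rewrite rmorphD rmorphM rmorphB rmorphM rmorphXn /= uniX eqxx !uni_free //.
rewrite coefD coefCM coefB coefXn coefCM coefX coefC eqxx.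
by rewrite (gtn_eqF (q_gt1 F)) (gtn_eqF (q_gt0 F)) mulr0 subr0 mulr1 addr0 => /eqP.
Qed.

Lemma size_uni_additive_poly : (1 < size (uni i additive_poly))%N.
Proof.
rewrite /additive_poly -[X in uni i X]mul1r -[X in uni i X]addr0.
apply: size_uni_additive; rewrite ?oner_neq0 // /free_of ?rmorph1 ?rmorph0 //.
by rewrite rmorphXn /= subst1X eq_sym (negPf ij).
Qed.

(** By invariance f minus its value f_0 at ['X_i = 0] vanishes at all multiples c X_j, hence is
    divisible by [additive_poly]; the quotient is again invariant and has smaller degree. *)
Lemma translation_invariant (f : A) :
  (forall c, subst1 i ('X_i + c%:MP * 'X_j) f = f) ->
  exists Q, f = subst1 i additive_poly Q.
Proof.
have ji : (j == i) = false by rewrite eq_sym (negPf ij).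
have [N] := ubnP (size (uni i f)); elim: N f => // N IH f; rewrite ltnS => szf inv.
have subX c (g g' : A) : subst1 i g' (subst1 i ('X_i + c%:MP * 'X_j) g)
    = subst1 i (g' + c%:MP * 'X_j) g.
  rewrite {1 2}/subst1 subst_comp; apply: eq_subst => l; case: (eqVneq l i) => [_|li].
    by rewrite -/(subst1 i g' _) rmorphD rmorphM /= !subst1X subst1C eqxx ji.
  by rewrite -/(subst1 i g' _) subst1X (negPf li).
set f0 := subst1 i 0 f.
have free0 : free_of i f0 by apply: free_subst1; apply: free_of0.
have [|h fh] := @vanish_multiples (enum F) (f - f0) (enum_uniq _).
  move=> c _; rewrite rmorphB /= (free_ofE _ free0) -{1}(add0r (c%:MP * 'X_j)).
  by rewrite -subX inv subrr.
rewrite big_enum -additive_polyE in fh.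
have inv_D c : subst1 i ('X_i + c%:MP * 'X_j) additive_poly = additive_poly.
  rewrite additive_polyE rmorph_prod /= [RHS](reindex_inj (addIr (- c))) /=.
  apply: eq_bigr => d _; rewrite rmorphB rmorphM /= !subst1X subst1C eqxx ji.
  by rewrite mpolyCB; ring.
have szD := size_uni_additive_poly.
have nzuD : uni i additive_poly != 0 by rewrite -size_poly_gt0 ltnW.
have nzD : additive_poly != 0 by apply: contraNneq nzuD => ->; rewrite rmorph0.
have [h0|nzh] := eqVneq h 0.
  by exists f0; rewrite free_ofE //; apply/eqP; rewrite -subr_eq0 fh h0 mulr0.
have [|c|Q hQ] := IH h.
- apply: leq_trans szf; rewrite -[f](subrK f0) fh rmorphD rmorphM /= (uni_free free0).
  have nzuh : uni i h != 0.
    by apply: contraNneq nzh => uh; apply/eqP/(@uni_inj _ _ i); rewrite uh rmorph0.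
  have szuh : (0 < size (uni i h))%N by rewrite size_poly_gt0.
  have szDh : (size (uni i h) < size (uni i additive_poly * uni i h)%R)%N.
    have lt_pred a b : (1 < a)%N -> (0 < b)%N -> (b < (a + b).-1)%N by lia.
    by rewrite (size_mul nzuD nzuh); apply: lt_pred szD szuh.
  have sz0 := leq_ltn_trans (size_polyC_leq1 f0) (leq_ltn_trans szuh szDh).
  by rewrite (size_polyDl sz0).
- apply: (mulfI nzD); rewrite -{1}(inv_D c) -rmorphM /= -fh rmorphB /= inv.
  by rewrite (free_ofE _ free0).
exists (f0 + 'X_i * Q).
by rewrite rmorphD rmorphM /= subst1X eqxx -hQ -fh free_ofE // subrKC.
Qed.
End Translations.
End OneVariableInvariants.

Lemma subst_closed (K : fieldType) (k n : nat) (g : 'I_k -> {mpoly K[n]})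
    (C : {mpoly K[n]} -> Prop) :
  (forall c, C c%:MP) -> (forall a b, C a -> C b -> C (a + b)) ->
  (forall a b, C a -> C b -> C (a * b)) -> (forall i, C (g i)) ->
  forall P, C (subst g P).
Proof.
move=> CC CD CM Cg P; rewrite substE.
elim/big_ind: _ => [|//|mu _]; first by rewrite -mpolyC0.
rewrite -mul_mpolyC; apply: (CM) => //; elim/big_ind: _ => [|//|i _]; first by rewrite -mpolyC1.
by elim: (mu i) => [|e IH]; rewrite ?expr0 -?mpolyC1 // exprS; apply: (CM).
Qed.

Section Generation.
Variables (F : finFieldType) (m : nat).
Notation q := #|F|.
Notation S := {mpoly F[m + m]}.
Notation s := (2 * m - 2 + (m + m))%N.
Variables (p r : nat) (p_pr : prime p) (r_gt0 : (0 < r)%N) (cardF : q = (p ^ r)%N).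
Notation T := {mpoly F[s]}.
Notation fv := (flagvar F m).

Let q1 : (1 < q)%N := @q_gt1 F.
Let qA n : [pchar {mpoly F[n]}].-nat q := pnat_qmpoly p_pr cardF n.

Definition flagsub (h : nat -> S) : S -> S := subst (fun i : 'I_(m + m) => h (rev_ord i)).
HB.instance Definition _ h := GRing.RMorphism.on (flagsub h).

Lemma flagsubV h a : (a < m + m)%N -> flagsub h (fv a) = h a.
Proof.
by move=> ha; rewrite (flagvarE _ ha) /flagsub substX rev_ordK.
Qed.

Lemma flagsubC h c : flagsub h c%:MP = c%:MP. Proof. exact: substC. Qed.

Lemma flag_ext (f g : {rmorphism S -> S}) :
  (forall c, f c%:MP = g c%:MP) ->
  (forall a, (a < m + m)%N -> f (fv a) = g (fv a)) -> f =1 g.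
Proof.
move=> fgC fgV; apply: mpoly_morph_ext => // i.
by rewrite -flagvar_ord; apply: fgV; apply: ltn_ord.
Qed.

Definition vsub b (g : S) := flagsub (fun d => if d == b then g else fv d).
HB.instance Definition _ b g := GRing.RMorphism.on (vsub b g).

Lemma vsubC b g c : vsub b g c%:MP = c%:MP. Proof. exact: substC. Qed.

Lemma vsubV b g d : (d < m + m)%N -> vsub b g (fv d) = if d == b then g else fv d.
Proof. exact: flagsubV. Qed.

Lemma vsubE b (hb : (b < m + m)%N) g : vsub b g =1 subst1 (vidx hb) g.
Proof.
move=> f; apply: eq_subst => i; rewrite flagvar_ord.
rewrite (_ : (rev_ord i == b :> nat) = (i == vidx hb)) // -val_eqE /=.
have im := ltn_ord i; apply/eqP/eqP; lia.
Qed.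

Lemma vidxE b (hb : (b < m + m)%N) : fv b = 'X_(vidx hb).
Proof. exact: flagvarE. Qed.

Lemma matsubC A c : matsub A c%:MP = c%:MP :> S. Proof. exact: substC. Qed.

(** The term with [e] is the one forced by the symplectic condition. For a + b = 2m - 1 both
    positions coincide and only one term remains, whence e = 0. *)
Lemma matsub_root a b c (ha : (a < m + m)%N) (hb : (b < m + m)%N) :
  (a < b)%N -> (a + b <= m.*2.-1)%N ->
  exists2 e : F, (a + b = m.*2.-1)%N -> e = 0 &
  forall d, (d < m + m)%N -> matsub (rootelt (vidx hb) (vidx ha) c) (fv d) =
    fv d + ((d == b)%:R * c)%:MP * fv a
         + ((d == m.*2.-1 - a)%N%:R * e)%:MP * fv (m.*2.-1 - b)%N.
Proof.
move=> ab abm; set i := vidx hb; set j := vidx ha.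
pose w := if j == rev_ord i then 0 else sgn F i * sgn F j.
exists (- (c * w)) => [E|d hd].
  by rewrite /w ifT ?mulr0 ?oppr0 // -val_eqE /=; lia.
have lin1 (i0 i1 j1 : 'I_(m + m)) (x : F) :
    \sum_l (x * delta_mx i1 j1 i0 l)%:MP * 'X_l = (x * (i0 == i1)%:R)%:MP * 'X_j1 :> S.
  rewrite (bigD1 j1) //= big1 ?addr0 => [|l lj]; first by rewrite mxE eqxx andbT.
  by rewrite mxE (negPf lj) andbF mulr0 mpolyC0 mul0r.
rewrite (vidxE hd) /matsub substX.
under eq_bigr => l _.
  rewrite (_ : rootelt i j c (vidx hd) l = (vidx hd == l)%:R + (c * delta_mx i j (vidx hd) l
    + - (c * w) * delta_mx (rev_ord j) (rev_ord i) (vidx hd) l)); last first.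
    by rewrite /rootelt /rootmx !mxE -/w; ring.
  rewrite !mpolyCD !mulrDl; over.
rewrite !big_split /= !lin1 addrA; congr (_ + _ + _).
- rewrite (bigD1 (vidx hd)) //= eqxx mpolyC1 mul1r big1 ?addr0 // => l.
  by rewrite eq_sym => /negPf ->; rewrite mpolyC0 mul0r.
- rewrite (mulrC c) (vidxE ha); congr ((_ * _)%:MP * _).
  by rewrite (inj_eq rev_ord_inj) -val_eqE.
have hb' : (m.*2.-1 - b < m + m)%N by lia.
rewrite (mulrC (- _)) (vidxE hb'); congr ((_%:R * _)%:MP * 'X_ _).
  rewrite -val_eqE /= ; congr nat_of_bool; apply/eqP/eqP; lia.
by apply: val_inj => /=; lia.
Qed.

(** The pairs (a, b) and (2m - 1 - b, 2m - 1 - a) give the same root subgroup; the bound on a + b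
    selects a representative. *)
Definition root_invariant k (f : S) := forall a b c
    (ha : (a < m + m)%N) (hb : (b < m + m)%N),
  (k <= a)%N -> (a < b)%N -> (a + b <= m.*2.-1)%N ->
  matsub (rootelt (vidx hb) (vidx ha) c) f = f.

Lemma generation_base (f : S) : exists P : T, f = evg m P.
Proof.
exists (subst (fun i => 'X_(rshift (2 * m - 2) (rev_ord i))) f).
rewrite /evg subst_comp -[LHS]subst_id; apply: eq_subst => i.
rewrite substX /gens split_rshift ifF; last by lia.
by rewrite flagvar_ord.
Qed.

(** * Invariants at level k from those at level k + 1 *)

Section Step.
Variable k : nat.
Hypothesis k_lt : (k < m)%N.
Notation u := (level F m k).
Notation u' := (level F m k.+1).
Notation y := (m.*2.-1 - k)%N.
Notation xi1 := (sympform q u (m - k) 1).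

Lemma bottom_lt : (k < m + m)%N. Proof. by lia. Qed.
Lemma top_lt : (y < m + m)%N. Proof. by lia. Qed.

Definition lin1 (t : S) := t ^+ q - fv k ^+ q.-1 * t.

Lemma lin1E t : lin1 t = flagop q u 1 t.
Proof. by rewrite /= /level addn0. Qed.

(** Up to terms free of y, xi_1 is x E_1(y); after inverting x, E_1(y) may be traded for xi_1. *)
Lemma xi1_expand : exists2 g, xi1 = fv k * lin1 (fv y) + g & free_of (vidx top_lt) g.
Proof.
have -> : (m - k = (m - k.+1).+1)%N by lia.
rewrite /sympform big_ord_recl /= subn0 /level addn0 expn1.
have -> : (k + ((m - k.+1).*2).+1 = y)%N by lia.
set g := \sum_(i < _) _; exists g; last first.
  rewrite /free_of rmorph_sum /=; apply: eq_bigr => l _; have lm := ltn_ord l.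
  have fv_free d : d != y -> subst1 (vidx top_lt) 0 (fv d) = fv d by apply: flagvar_free.
  by rewrite rmorphB !rmorphM !rmorphXn /= !fv_free // /bump; apply/eqP; lia.
congr (_ + _); rewrite /lin1 mulrBr mulrA -exprS prednK ?q_gt0 //.
by rewrite (mulrC (fv k)) (mulrC (fv y)).
Qed.

Lemma size_uni_xi1 : (1 < size (uni (vidx top_lt) xi1))%N.
Proof.
have [g -> fg] := xi1_expand; rewrite /lin1 (vidxE top_lt).
apply: size_uni_additive => //; rewrite ?flagvar_neq0 ?bottom_lt //.
  by apply: flagvar_free; apply/eqP; lia.
by rewrite /free_of rmorphXn /= flagvar_free //; apply/eqP; lia.
Qed.

Lemma vsub_xi1_inj : injective (vsub y xi1).
Proof.
by move=> f g; rewrite !(vsubE top_lt); apply: subst1_inj; apply: size_uni_xi1.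
Qed.

Lemma vsub_lin1_inj b : (k < b < m + m)%N -> injective (vsub b (lin1 (fv b))).
Proof.
move=> /andP [kb hb] f g; rewrite !(vsubE hb); apply: subst1_inj.
rewrite /lin1 (vidxE hb) (vidxE bottom_lt).
by apply: size_uni_additive_poly; rewrite (inj_eq rev_ord_inj) -val_eqE /= gtn_eqF.
Qed.

Lemma vsub_translation b (f : S) : (k < b < m + m)%N ->
  (forall c, vsub b (fv b + c%:MP * fv k) f = f) ->
  exists Q, f = vsub b (lin1 (fv b)) Q.
Proof.
move=> /andP [kb hb] inv.
have [||Q fQ] := @translation_invariant F _ (vidx hb) (vidx bottom_lt) _ f.
- by rewrite (inj_eq rev_ord_inj) -val_eqE /= gtn_eqF.
- by move=> c; rewrite -vsubE -!vidxE.
by exists Q; rewrite (vsubE hb) fQ /additive_poly -!vidxE.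
Qed.

Lemma clear_denominators Q0 : exists K Q1,
  fv k ^+ K * vsub y (lin1 (fv y)) Q0 = vsub y xi1 Q1.
Proof.
pose C f := exists K Q1, fv k ^+ K * f = vsub y xi1 Q1.
have fixk e : vsub y xi1 (fv k ^+ e) = fv k ^+ e.
  by rewrite rmorphXn /= vsubV ?bottom_lt // ifF //; apply/eqP; lia.
apply: (@subst_closed _ _ _ _ C) => [c|a b [K [A aA]] [L [B bB]]|a b [K [A aA]] [L [B bB]]|i].
- by exists 0%N, c%:MP; rewrite mul1r vsubC.
- exists (K + L)%N, (fv k ^+ L * A + fv k ^+ K * B).
  by rewrite rmorphD !rmorphM /= !fixk -aA -bB exprD; ring.
- by exists (K + L)%N, (A * B); rewrite rmorphM /= -aA -bB exprD; ring.
case: eqP => [_|/eqP iy]; last first.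
  by exists 0%N, (fv (rev_ord i)); rewrite mul1r vsubV ?ltn_ord // (negPf iy).
have [g xig fg] := xi1_expand.
exists 1%N, (fv y - g); rewrite rmorphB /= vsubV ?top_lt // eqxx (vsubE top_lt) free_ofE //.
by rewrite xig expr1 addrK.
Qed.

Definition midsub N d := if (k < d < k.+1 + N)%N then lin1 (fv d) else fv d.

Lemma midsubS N Q : (k.+1 + N < m + m)%N -> let b := (k.+1 + N)%N in
  flagsub (midsub N.+1) Q = flagsub (midsub N) (vsub b (lin1 (fv b)) Q).
Proof.
move=> hb b; move: Q;
apply: (flag_ext (f := flagsub _) (g := flagsub _ \o vsub _ _)) => [c|d hd] /=.
  by rewrite vsubC !flagsubC.
rewrite (vsubV _ _ hd) (flagsubV _ hd) {1}/midsub; case: (eqVneq d b) => [->|db].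
  rewrite ifT; last by rewrite /b; lia.
  rewrite /lin1 rmorphB rmorphM !rmorphXn /= !flagsubV ?bottom_lt //.
  by rewrite /midsub ltnn /= ltnn andbF.
rewrite flagsubV // /midsub (_ : (k < d < k.+1 + N.+1) = (k < d < k.+1 + N))%N //.
by move: db; rewrite /b; lia.
Qed.

Lemma midsub0 Q : flagsub (midsub 0) Q = Q.
Proof.
apply: (flag_ext (f := flagsub _) (g := idfun)) => [c|d hd] /=; first exact: flagsubC.
by rewrite flagsubV // /midsub ifF //; lia.
Qed.

Lemma midsub_inj N : (k.+1 + N <= m + m)%N -> injective (flagsub (midsub N)).
Proof.
elim: N => [|N IH] hN f g; first by rewrite !midsub0.
rewrite !midsubS; [|by lia..] => /IH fg.
by apply: (@vsub_lin1_inj (k.+1 + N)); [lia|apply: fg; lia].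
Qed.

Lemma vsub_commute b b' c Q : (k < b < m + m)%N -> (k < b' < m + m)%N -> b != b' ->
  vsub b' (fv b' + c%:MP * fv k) (vsub b (lin1 (fv b)) Q) =
  vsub b (lin1 (fv b)) (vsub b' (fv b' + c%:MP * fv k) Q).
Proof.
move=> /andP [kb hb] /andP [kb' hb'] bb'; move: Q.
have kN b0 : (k < b0)%N -> (k == b0) = false by move=> ?; rewrite ltn_eqF.
apply: (flag_ext (f := vsub _ _ \o vsub _ _) (g := vsub _ _ \o vsub _ _)) => [c0|d hd] /=.
  by rewrite !vsubC.
rewrite !(vsubV _ _ hd); case: (eqVneq d b) => [->|db].
  rewrite (negPf bb') vsubV // eqxx /lin1 rmorphB rmorphM !rmorphXn /=.
  by rewrite !vsubV ?bottom_lt // (negPf bb') kN.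
case: (eqVneq d b') => [->|db'].
  rewrite vsubV // eqxx rmorphD rmorphM /= vsubC !vsubV ?bottom_lt //.
  by rewrite eq_sym (negPf bb') kN.
by rewrite !vsubV // (negPf db) (negPf db').
Qed.

(** The middle coordinates are treated one at a time. By [vsub_commute] and injectivity the preimage
    stays invariant under translations of the later ones. *)
Lemma mid_invariants Q1 :
  (forall b c, (k < b < y)%N -> vsub b (fv b + c%:MP * fv k) Q1 = Q1) ->
  exists Q, Q1 = flagsub (midsub (y - k.+1)) Q.
Proof.
move=> inv; suff [Q [QQ _]] : exists Q, Q1 = flagsub (midsub (y - k.+1)) Q /\
  forall b c, (k.+1 + (y - k.+1) <= b < y)%N -> vsub b (fv b + c%:MP * fv k) Q = Q.
  by exists Q.
have : (y - k.+1 <= y - k.+1)%N by [].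
move: {1 3 4}(y - k.+1)%N => N; elim: N => [|N IH] hN.
  by exists Q1; rewrite midsub0; split=> // b c; rewrite addn0; apply: inv.
have [|Q [QQ invQ]] := IH; first by lia.
set b := (k.+1 + N)%N; have kb : (k < b < m + m)%N by rewrite /b; lia.
have [c|Q' Q'Q] := @vsub_translation b Q kb; first by apply: invQ; rewrite /b; lia.
exists Q'; split=> [|b' c hb']; first by rewrite midsubS -?Q'Q //; lia.
apply: (vsub_lin1_inj kb); rewrite -vsub_commute -?Q'Q //; last by rewrite /b; lia.
  by apply: invQ; lia.
lia.
Qed.

(** The form of the full space is that of level k plus the pairs removed before, and the root
    element fixes every coordinate in those pairs. *)
Lemma root_xi1 a b c (ha : (a < m + m)%N) (hb : (b < m + m)%N) (i : nat) :
  (k <= a)%N -> (a < b)%N -> (a + b <= m.*2.-1)%N ->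
  matsub (rootelt (vidx hb) (vidx ha) c) (sympform q u (m - k) i) = sympform q u (m - k) i.
Proof.
move=> ka ab abm; set A := rootelt _ _ c.
have [e e0 Av] := matsub_root c ha hb ab abm.
have outer d : (d < k)%N || (y < d < m + m)%N -> matsub A (fv d) = fv d.
  move=> hd; rewrite Av; last by lia.
  rewrite (_ : (d == b) = false); last by apply/eqP; lia.
  rewrite (_ : (d == m.*2.-1 - a)%N = false); last by apply/eqP; lia.
  by rewrite !mul0r !addr0.
have USpA : USp A by apply: rootelt_USp; rewrite /=; lia.
have split_form : sympform q fv m i = sympform q u (m - k) i +
    \sum_(l < k) (fv (m.*2.-1 - l)%N ^+ (q ^ i) * fv l - fv (m.*2.-1 - l)%N * fv l ^+ (q ^ i)).
  pose term l := fv (m.*2.-1 - l)%N ^+ (q ^ i) * fv l - fv (m.*2.-1 - l)%N * fv l ^+ (q ^ i).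
  rewrite -[LHS]/(\sum_(l < m) term l) -[X in _ + X]/(\sum_(l < k) term l).
  rewrite -!(big_mkord xpredT term).
  rewrite (big_cat_nat (n := k)) ?(ltnW k_lt) //= addrC; congr (_ + _).
  rewrite -{1}[k]add0n big_addn big_mkord; apply: eq_bigr => l _; rewrite /term.
  have lm := ltn_ord l; rewrite /level addnC.
  by have -> : (m.*2.-1 - (k + l) = k + ((m - k).*2.-1 - l))%N by lia.
have := sympform_inv p_pr cardF i USpA; rewrite split_form rmorphD /=.
rewrite [X in _ + X = _]rmorph_sum /=.
under [X in _ + X = _ -> _]eq_bigr => l _.
  have lk := ltn_ord l.
  rewrite rmorphB !rmorphM !rmorphXn /= !outer; [over|lia..].
by move/addIr.
Qed.

(** The root element also moves y, but y has been replaced by the invariant xi_1, so only the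
    translation of coordinate b remains visible. *)
Lemma root_vsub_xi1 b c (hb : (b < m + m)%N) Q : (k < b < y)%N ->
  matsub (rootelt (vidx hb) (vidx bottom_lt) c) (vsub y xi1 Q) =
  vsub y xi1 (vsub b (fv b + c%:MP * fv k) Q).
Proof.
move=> kby; have kb : (k < b)%N by lia.
have kbm : (k + b <= m.*2.-1)%N by lia.
have [e e0 Av] := matsub_root c bottom_lt hb kb kbm.
move: Q; set A := rootelt _ _ _.
apply: (flag_ext (f := matsub A \o vsub _ _) (g := vsub _ _ \o vsub _ _)) => [c0|d hd] /=.
  by rewrite !vsubC matsubC.
rewrite !(vsubV _ _ hd); case: (eqVneq d y) => [->|dy].
  rewrite root_xi1 // (_ : (y == b) = false); last by apply/eqP; lia.
  by rewrite vsubV ?top_lt // eqxx.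
rewrite Av // (negPf dy) mul0r mpolyC0 mul0r addr0.
case: (eqVneq d b) => [->|db]; last by rewrite mul0r mpolyC0 mul0r addr0 vsubV // (negPf dy).
rewrite mul1r rmorphD rmorphM /= vsubC !vsubV ?bottom_lt // !ifF //; apply/eqP; lia.
Qed.

Lemma bottom_neq_top : (k == y) = false. Proof. by apply/eqP; lia. Qed.

Lemma root_long_vsub c Q :
  matsub (rootelt (vidx top_lt) (vidx bottom_lt) c) Q = vsub y (fv y + c%:MP * fv k) Q.
Proof.
have k_lt_m := k_lt; have ky : (k < y)%N by lia.
have kyE : (k + y = m.*2.-1)%N by lia.
have [|e /(_ kyE) -> Av] := matsub_root c bottom_lt top_lt ky; first by rewrite kyE.
move: Q; apply: (flag_ext (f := matsub _) (g := vsub _ _)) => [c0|d hd] /=.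
  by rewrite vsubC matsubC.
rewrite (Av _ hd) (vsubV _ _ hd) mulr0 mpolyC0 mul0r addr0.
by case: (eqVneq d y) => [->|_]; rewrite ?mul1r // mul0r mpolyC0 mul0r addr0.
Qed.

Definition fullsub d :=
  if d == y then xi1 else if (k < d < y)%N then lin1 (fv d) else fv d.

Lemma fullsubE Q : flagsub fullsub Q = vsub y xi1 (flagsub (midsub (y - k.+1)) Q).
Proof.
have k_lt_m := k_lt; have k_2m := bottom_lt; have y_2m := top_lt.
move: Q; apply: (flag_ext (f := flagsub _) (g := vsub _ _ \o flagsub _)) => [c0|d hd] /=.
  by rewrite !flagsubC vsubC.
have range : (k < d < k.+1 + (y - k.+1))%N = (k < d < y)%N by lia.
rewrite !(flagsubV _ hd) /fullsub /midsub range.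
case: (eqVneq d y) => [->|dy].
  by rewrite ltnn andbF (vsubV _ _ y_2m) eqxx.
case: ifP => _; last by rewrite (vsubV _ _ hd) (negPf dy).
rewrite /lin1 rmorphB rmorphM !rmorphXn /= (vsubV _ _ hd) (vsubV _ _ k_2m).
by rewrite (negPf dy) bottom_neq_top.
Qed.

Lemma fullsub_inj : injective (flagsub fullsub).
Proof.
have k_lt_m := k_lt.
move=> f g; rewrite !fullsubE => /vsub_xi1_inj /midsub_inj; apply; lia.
Qed.

Lemma lin1D t1 t2 : lin1 (t1 + t2) = lin1 t1 + lin1 t2.
Proof. by rewrite !lin1E (flagopD (qA _)). Qed.

Lemma lin1Z c t : lin1 (c%:MP * t) = c%:MP * lin1 t.
Proof.
rewrite !lin1E flagopZ //; have := expq_const c 1 (m + m).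
by rewrite expn1.
Qed.

(** xi_1 is invariant and E_1 is linear over the finite field, so root elements fixing x act on the
    E_1 of the middle coordinates as on the coordinates themselves. *)
Lemma root_fullsub a b c (ha : (a < m + m)%N) (hb : (b < m + m)%N) Q :
  (k < a)%N -> (a < b)%N -> (a + b <= m.*2.-1)%N ->
  matsub (rootelt (vidx hb) (vidx ha) c) (flagsub fullsub Q) =
  flagsub fullsub (matsub (rootelt (vidx hb) (vidx ha) c) Q).
Proof.
move=> ka ab abm; have k_lt_m := k_lt; have k_2m := bottom_lt; have y_2m := top_lt.
have xi_inv : matsub (rootelt (vidx hb) (vidx ha) c) xi1 = xi1.
  by apply: root_xi1 => //; apply: ltnW.
have [e _ Av] := matsub_root c ha hb ab abm.
move: xi_inv Av; set A := rootelt _ _ c => xi_inv Av.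
have outer d : (d < m + m)%N -> ~~ (k < d < y)%N -> matsub A (fv d) = fv d.
  move=> hd kdy; rewrite (Av _ hd) (_ : (d == b) = false); last by apply/eqP; lia.
  rewrite (_ : (d == m.*2.-1 - a)%N = false); last by apply/eqP; lia.
  by rewrite !mul0r !addr0.
move: Q;
apply: (flag_ext (f := matsub A \o flagsub _) (g := flagsub _ \o matsub A))
  => [c0|d hd] /=.
  by rewrite !matsubC !flagsubC matsubC.
rewrite (flagsubV _ hd) /fullsub; case: (eqVneq d y) => [->|dy].
  rewrite xi_inv (outer _ y_2m); last by rewrite ltnn andbF.
  by rewrite (flagsubV _ y_2m) eqxx.
case: ifP => kdy; last first.
  by rewrite (outer _ hd) ?kdy // (flagsubV _ hd) (negPf dy) kdy.
have -> : matsub A (lin1 (fv d)) = lin1 (matsub A (fv d)).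
  rewrite /lin1 rmorphB rmorphM !rmorphXn /= (outer _ k_2m) //.
  by rewrite ltnn.
have hbb : (m.*2.-1 - b < m + m)%N by lia.
have ay : (a == y) = false by apply/eqP; lia.
have by_ : (m.*2.-1 - b == y)%N = false by apply/eqP; lia.
have kay : (k < a < y)%N by lia.
have kby : (k < m.*2.-1 - b < y)%N by lia.
rewrite (Av _ hd) !lin1D !lin1Z !rmorphD !rmorphM /= !flagsubC.
by rewrite (flagsubV _ hd) (flagsubV _ ha) (flagsubV _ hbb) (negPf dy) kdy ay kay by_ kby.
Qed.

Definition generated f := exists P : T, f = evg k P.

Lemma generatedC c : generated c%:MP.
Proof. by exists c%:MP; rewrite /evg substC. Qed.
Lemma generatedD f g : generated f -> generated g -> generated (f + g).
Proof. by move=> [P ->] [Q ->]; exists (P + Q); rewrite rmorphD. Qed.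
Lemma generatedM f g : generated f -> generated g -> generated (f * g).
Proof. by move=> [P ->] [Q ->]; exists (P * Q); rewrite rmorphM. Qed.
Lemma generatedN f : generated f -> generated (- f).
Proof. by move=> [P ->]; exists (- P); rewrite rmorphN. Qed.
Lemma generatedX f e : generated f -> generated (f ^+ e).
Proof. by move=> [P ->]; exists (P ^+ e); rewrite rmorphXn. Qed.

Lemma generated_fv d : ~~ (k < d < m + m - k)%N -> generated (fv d).
Proof.
move=> kd; exists (nvar F m d); case: (eqVneq d k) => [->|dk]; last first.
  by rewrite evg_nvar_out //; lia.
by rewrite (evg_nvar p_pr cardF); [rewrite subnn /orbprod /= /level addn0|have := k_lt; lia].
Qed.

Lemma generated_sympform l : (l < (m - k).*2)%N -> generated (sympform q u (m - k) l).
Proof. by move=> lk; exists (xforms F m k l); rewrite (evg_xforms p_pr cardF). Qed.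

Lemma generated_twist l i : (l < (m - k).*2)%N -> (i <= l)%N ->
  generated (twist q (sympform q u (m - k)) l i).
Proof.
by move=> lk il; rewrite /twist il; apply/generatedX/generated_sympform; lia.
Qed.

Lemma fullsub_level b : (b < (m - k.+1).*2)%N ->
  flagsub fullsub (u' b) = flagop q u 1 (u b.+1).
Proof.
move=> bk; have k_lt_m := k_lt; rewrite -lin1E {2}/level -addSnnS.
have hb : (k.+1 + b < m + m)%N by lia.
rewrite (flagsubV _ hb) /fullsub (_ : (k.+1 + b == y) = false); last by apply/eqP; lia.
by rewrite ifT //; lia.
Qed.

(** [sympform_shift] handles the forms and [orbprod_shift] the orbit products of level k + 1; the
    coordinate y goes to xi_1. *)
Lemma fullsub_generated (P : T) : generated (flagsub fullsub (evg k.+1 P)).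
Proof.
have k_lt_m := k_lt.
rewrite /evg /flagsub subst_comp -/(flagsub fullsub).
apply: (@subst_closed _ _ _ _ generated) => [|||i].
- exact: generatedC.
- exact: generatedD.
- exact: generatedM.
rewrite -/(flagsub fullsub _) /gens; case: split_ordP => [j _|a _].
  case: ifP => jk; last by rewrite rmorph0 -mpolyC0; apply: generatedC.
  rewrite sympform_morph.
  have -> : sympform q (flagsub fullsub \o u') (m - k.+1) j.+1 =
    sympform q (fun b => flagop q u 1 (u b.+1)) (m - k.+1) j.+1.
    rewrite /sympform; apply: eq_bigr => l _; have lm := ltn_ord l.
    by rewrite -!fullsub_level //; lia.
  rewrite (sympform_shift (qA _) (q_gt1 F)) /level addn0.
  rewrite -(_ : (m - k = (m - k.+1).+1)%N); last by lia.
  rewrite -/u; have gk : generated (fv k) by apply: generated_fv; rewrite ltnn.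
  apply: generatedD.
    apply: generatedD.
      apply: generatedD; first by apply: generated_twist; lia.
      apply: generatedN; apply: generatedM; last by apply: generated_twist; lia.
      exact: generatedX.
    apply: generatedN; apply: generatedM; last by apply: generated_twist; lia.
    by do 2!apply: generatedX.
  apply: generatedM; last by apply: generated_twist; lia.
  by apply: generatedM; do ?apply: generatedX.
case: ifP => ka.
  exists (nvar F m a); rewrite (evg_nvar p_pr cardF); last by lia.
  rewrite orbprod_morph (_ : a - k = (a - k.+1).+1)%N; last by lia.
  rewrite orbprod_shift /orbprod /= -/(flagsub _ _) fullsub_level; last by lia.
  by apply: eq_flagop => b ba /=; rewrite fullsub_level //; lia.
rewrite (flagsubV _ (ltn_ord a)) /fullsub; case: eqP => [_|/eqP ay].
  (* If m - k = 1, then xi_1 is not among the generators and is supplied by [xforms]. *)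
  by apply: generated_sympform; lia.
by rewrite ifF; [apply: generated_fv|]; lia.
Qed.

(* By the normal form and [evg_divides], a multiple of [fv k] in the algebra is
   [fv k] times an element of the algebra. *)
Lemma generated_divide K f : generated (fv k ^+ K * f) -> generated f.
Proof.
elim: K => [|K IH]; first by rewrite mul1r.
move=> [P]; have [B -> bB] := evg_normal_form p_pr cardF k P.
rewrite exprS -mulrA => /esym Bf; apply: IH.
have [Q fQ _] := evg_divides p_pr r_gt0 cardF k_lt bB Bf.
by exists Q.
Qed.

Lemma generation_step :
  (forall f, root_invariant k.+1 f -> exists P : T, f = evg k.+1 P) ->
  forall f, root_invariant k f -> generated f.
Proof.
move=> IH f inv; have k_lt_m := k_lt.
(* The root subgroup translating y by multiples of x makes f a polynomial in E_1(y); a power of x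
   then converts it into one in xi_1. *)
have [||Q0 fQ0] := @vsub_translation y f; first by lia.
  move=> c; rewrite -root_long_vsub; apply: inv; lia.
have [K [Q1 fQ1]] := clear_denominators Q0; rewrite -fQ0 in fQ1.
(* The remaining root subgroups involving x translate the middle coordinates. *)
have [b c kby|Q Q1Q] := @mid_invariants Q1.
  have hb : (b < m + m)%N by lia.
  have kb : (k < b)%N by lia.
  have kbm : (k + b <= m.*2.-1)%N by lia.
  apply: vsub_xi1_inj; rewrite -(root_vsub_xi1 c hb Q1 kby) -fQ1 rmorphM rmorphXn /=.
  rewrite (inv _ _ c bottom_lt hb (leqnn k) kb kbm).
  have [e e0 Av] := matsub_root c bottom_lt hb kb kbm.
  rewrite (Av _ bottom_lt) (_ : (k == b) = false); last by apply/eqP; lia.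
  by rewrite bottom_neq_top !mul0r !addr0.
rewrite Q1Q -fullsubE in fQ1.
(* The root subgroups of level k + 1 pass to [Q] through the injective [flagsub fullsub]. *)
have [|P QP] := IH Q.
  move=> a b c ha hb ka ab abm; apply: fullsub_inj.
  rewrite -(root_fullsub c ha hb Q ka ab abm) -fQ1 rmorphM rmorphXn /=.
  rewrite (inv _ _ c ha hb (ltnW ka) ab abm).
  have [e e0 Av] := matsub_root c ha hb ab abm.
  rewrite (Av _ bottom_lt) (_ : (k == b) = false); last by apply/eqP; lia.
  rewrite (_ : (k == m.*2.-1 - a)%N = false); last by apply/eqP; lia.
  by rewrite !mul0r !addr0.
by apply: (@generated_divide K); rewrite fQ1 QP; apply: fullsub_generated.
Qed.

End Step.

Theorem generation f : root_invariant 0 f -> exists P : T, f = evg 0 P.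
Proof.
have gen d : (d <= m)%N -> forall g, root_invariant (m - d) g -> exists P : T, g = evg (m - d) P.
  elim: d => [|d IH] dm g inv; first by rewrite subn0; apply: generation_base.
  apply: (@generation_step (m - d.+1)) inv; first by lia.
  by rewrite (_ : (m - d.+1).+1 = m - d)%N; [apply: IH; apply: ltnW|lia].
by have := gen m (leqnn m) f; rewrite subnn.
Qed.

End Generation.

(** * Orbit products over subspaces, and the main theorem *)

Lemma submx_coordinates (K : fieldType) (n : nat) (U : 'M[K]_n) (Q : pred 'I_n)
    (v : 'rV[K]_n) :
  (forall i, Q i -> ((delta_mx 0 i : 'rV_n) <= U)%MS) ->
  (forall i, ~~ Q i -> (U <= kermx (delta_mx i (0 : 'I_1)))%MS) ->
  (v <= U)%MS = [forall i, ~~ Q i ==> (v 0 i == 0)].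
Proof.
move=> QU UQ; apply/idP/forallP => [vU i|v0].
  apply/implyP => /UQ /(submx_trans vU) /sub_kermxP /matrixP /(_ 0 0).
  rewrite !mxE (bigD1 i) //= mxE !eqxx mulr1 big1 ?addr0 => [->//|j ji].
  by rewrite mxE (negPf ji) mulr0.
rewrite [v]row_sum_delta; apply: summx_sub => i _.
have [Qi|/(implyP (v0 i)) /eqP ->] := boolP (Q i); first exact/scalemx_sub/QU.
by rewrite scale0r sub0mx.
Qed.

Lemma delta_sub_kermx (K : fieldType) (n : nat) (i j : 'I_n) : j != i ->
  (<<(delta_mx 0 j : 'rV[K]_n)>> <= kermx (delta_mx i (0 : 'I_1)))%MS.
Proof.
move=> ji; rewrite genmxE; apply/sub_kermxP.
by rewrite mul_delta_mx_cond (negPf ji).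
Qed.

Section OrbitProducts.
Variables (F : finFieldType) (m : nat).
Notation q := #|F|.
Notation S := {mpoly F[m + m]}.
Variables (p r : nat) (p_pr : prime p) (cardF : q = (p ^ r)%N).
Notation fv := (flagvar F m).

Let q1 : (1 < q)%N := @q_gt1 F.
Let qA n : [pchar {mpoly F[n]}].-nat q := pnat_qmpoly p_pr cardF n.

Definition flagspan (a : nat) (v : 'rV[F]_(m + m)) :=
  [forall i : 'I_(m + m), ~~ (rev_ord i < a)%N ==> (v 0 i == 0)].

Lemma linformD (v w : 'rV[F]_(m + m)) : linform (v + w) = linform v + linform w.
Proof. by rewrite -big_split; apply: eq_bigr => i _; rewrite mxE scalerDl. Qed.

Lemma linformZ c (v : 'rV[F]_(m + m)) : linform (c *: v) = c%:MP * linform v.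
Proof.
by rewrite mulr_sumr; apply: eq_bigr => i _; rewrite mxE mul_mpolyC scalerA.
Qed.

(** Grouping the vectors by their coefficient c along the last basis vector gives the factors E_a(t)
    + c E_a(u_a), whose product over c is the recursion of [flagop]. *)
Lemma prod_flagspan a (t : S) : (a <= m + m)%N ->
  \prod_(v | flagspan a v) (t + linform v) = flagop q fv a t.
Proof.
elim: a t => [|a IH] t am.
  rewrite (big_pred1 0) => [|v].
    by rewrite /linform big1 ?addr0 // => i _; rewrite mxE scale0r.
  apply/forallP/eqP => [v0|-> i]; last by rewrite mxE eqxx implybT.
  by apply/rowP => i; rewrite mxE; apply/eqP; have := v0 i.
pose ia := vidx am.
rewrite (partition_big (fun v : 'rV[F]_(m + m) => v 0 ia) xpredT) //=.
pose X := flagop q fv a t; pose Y := flagop q fv a (fv a).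
transitivity (\prod_(c : F) (X - (- c)%:MP * Y)); last first.
  rewrite -(reindex_inj (@oppr_inj F) (P := xpredT) (F := fun c => X - c%:MP * Y)) /=.
  by rewrite (prod_sub_scaled (@mpolyC (m + m) F)).
apply: eq_bigr => c _; rewrite (reindex_inj (addIr (c *: delta_mx 0 ia))) /=.
transitivity (\prod_(w | flagspan a w) (t + c%:MP * fv a + linform w)).
  apply: eq_big => [w|w _]; last first.
    by rewrite linformD linformZ linform_delta -vidxE; ring.
  apply/andP/forallP => [[/forallP wa /eqP wc] i|wa].
    apply/implyP; rewrite -leqNgt leq_eqVlt => /orP [/eqP ai|ai].
      have -> : i = ia by apply: rev_ord_inj; apply: val_inj; rewrite rev_ordK; exact: (esym ai).
      move: wc; rewrite !mxE !eqxx mulr1 => /eqP.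
      by rewrite -subr_eq0 addrK.
    have := wa i; rewrite -leqNgt ai /= !mxE (_ : (i == ia) = false) ?andbF ?mulr0 ?addr0 //.
    by apply/eqP => iia; move: ai; rewrite iia rev_ordK /= ltnn.
  split; last first.
    rewrite !mxE !eqxx mulr1; have := wa ia; rewrite rev_ordK /= ltnn /= => /eqP ->.
    by rewrite add0r.
  apply/forallP => i; apply/implyP; rewrite -leqNgt => ai.
  have := wa i; rewrite -leqNgt ltnW //= !mxE => /eqP ->.
  rewrite (_ : (i == ia) = false) ?andbF ?mulr0 ?addr0 //.
  by apply/eqP => iia; move: ai; rewrite iia rev_ordK /= ltnn.
rewrite IH ?(ltnW am) // (flagopD (qA _)) flagopZ; last first.
  by have := expq_const c 1 (m + m); rewrite expn1.
by rewrite -/X -/Y mpolyCN mulNr opprK.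
Qed.

Lemma NxE (i : 'I_m) : Nx F i = orbprod q fv i.
Proof.
rewrite /Nx xE /orbprod -prod_flagspan; last by have := ltn_ord i; lia.
apply: eq_bigl => v; apply: submx_coordinates => l.
  move=> li; have hl : (rev_ord l < m)%N by apply: ltn_trans li _.
  apply: (submx_trans _ (sumsmx_sup (Ordinal hl) _ (submx_refl _))) => //.
  rewrite genmxE /xdual (_ : rshift m _ = l) ?submx_refl //.
  by apply: val_inj => /=; move: hl (ltn_ord l) => /=; lia.
move=> li; apply/sumsmx_subP => j ji; apply: delta_sub_kermx.
apply: contra li => /eqP <- /=; have := ltn_ord j; have := ltn_ord i; lia.
Qed.

Lemma NyE (k : 'I_m) : Ny (rev_ord k) (y F (rev_ord k)) = orbprod q fv (m + k).
Proof.
have km := ltn_ord k.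
rewrite /Ny yE /= (_ : (m.*2.-1 - (m - k.+1) = m + k)%N); last by lia.
rewrite /orbprod -prod_flagspan; last by lia.
apply: eq_bigl => v; apply: submx_coordinates => l /=; have lm := ltn_ord l.
  move=> li; have [lt_lm|le_ml] := ltnP l m.
    apply: (submx_trans _ (addsmxSr _ _)).
    apply: (submx_trans _ (sumsmx_sup (Ordinal lt_lm) _ (submx_refl _))) => /=; last by lia.
    by rewrite genmxE /ydual (_ : lshift m _ = l) ?submx_refl //; apply: val_inj.
  apply: (submx_trans _ (addsmxSl _ _)).
  have hl : (rev_ord l < m)%N by rewrite /=; lia.
  apply: (submx_trans _ (sumsmx_sup (Ordinal hl) _ (submx_refl _))) => //.
  rewrite genmxE /xdual (_ : rshift m _ = l) ?submx_refl //.
  by apply: val_inj => /=; lia.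
move=> li; rewrite addsmx_sub; apply/andP; split; apply/sumsmx_subP => j.
  move=> _; apply: delta_sub_kermx.
  by apply: contra li => /eqP <- /=; have := ltn_ord j; lia.
move=> /= ji; apply: delta_sub_kermx.
by apply: contra li => /eqP <- /=; have := ltn_ord j; lia.
Qed.

Lemma USp_generatorsE i : tnth (USp_generators F m) i = gens F 0 i.
Proof.
rewrite /gens subn0; case: split_ordP => [j ->|a ->].
  rewrite tnth_lshift tnth_mktuple xiE ifT //.
  by have := ltn_ord j; lia.
rewrite tnth_rshift leq0n subn0 ltn_ord /=.
case: (split_ordP a) => [j ->|j ->].
  by rewrite tnth_lshift tnth_mktuple NxE subn0.
by rewrite tnth_rshift tnth_mktuple NyE subn0.
Qed.

Lemma flagvar_homog a : fv a \is 1.-homog.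
Proof.
rewrite /flagvar; case: insubP => [i _ _|_]; last exact: dhomog0.
by rewrite dhomogX /= mdeg1.
Qed.

Lemma flagvar_exp_homog a e : fv a ^+ e \is e.-homog.
Proof. by have := dhomogMn e (flagvar_homog a); rewrite mul1n. Qed.

Lemma flagop_homog a t : t \is 1.-homog -> flagop q fv a t \is (q ^ a).-homog.
Proof.
elim: a t => [|a IH] t t1 //; rewrite [flagop _ _ _ _]/=; apply: rpredB.
  by rewrite expnSr; apply: dhomogMn; apply: IH.
have -> : (q ^ a.+1 = q ^ a * q.-1 + q ^ a)%N.
  by rewrite -mulnSr prednK ?q_gt0 // -expnSr.
apply: dhomogM; last exact: IH.
by apply: dhomogMn; apply: IH; apply: flagvar_homog.
Qed.

Lemma gens_homog (i : 'I_(2 * m - 2 + (m + m))) : exists d, gens F 0 i \is d.-homog.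
Proof.
rewrite /gens subn0; case: split => [j|a].
  case: ifP => _; last by exists 0%N; apply: dhomog0.
  exists (q ^ j.+1 + 1)%N; apply: rpred_sum => l _; apply: rpredB.
    apply: dhomogM; last exact: flagvar_homog.
    exact: flagvar_exp_homog.
  rewrite addnC; apply: dhomogM; first exact: flagvar_homog.
  exact: flagvar_exp_homog.
rewrite leq0n subn0 ltn_ord /=; exists (q ^ (a - 0))%N.
by apply: flagop_homog; apply: flagvar_homog.
Qed.

End OrbitProducts.

Lemma comp_mpoly_subst (K : fieldType) (k n : nat) (f : k.-tuple {mpoly K[n]}) P :
  P \mPo f = subst (tnth f) P.
Proof.
by rewrite /subst; congr (_ \mPo _); apply: eq_from_tnth => i; rewrite tnth_mktuple.
Qed.

(** * Invariance, kernel and minimality of the generators *)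

Section FinalStep.
Variables (F : finFieldType) (m : nat).
Notation q := #|F|.
Notation S := {mpoly F[m + m]}.
Notation s := (2 * m - 2 + (m + m))%N.
Notation T := {mpoly F[s]}.
Variables (p r : nat) (p_pr : prime p) (r_gt0 : (0 < r)%N) (cardF : q = (p ^ r)%N).

Lemma comp_USp_generators (P : T) : P \mPo USp_generators F m = evg 0 P.
Proof.
rewrite /evg /subst; congr (_ \mPo _); apply: eq_from_tnth => i.
by rewrite tnth_mktuple (USp_generatorsE p_pr cardF).
Qed.

Lemma USp_generators_inv i A : @USp F m A -> matsub A (gens F 0 i) = gens F 0 i.
Proof.
move=> USpA; rewrite /gens subn0; case: split => [j|a].
  by case: ifP => _; rewrite ?rmorph0 // (sympform_inv p_pr cardF).
by rewrite leq0n subn0 ltn_ord /= (orbprod_inv p_pr cardF).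
Qed.

Lemma invariants_generated : generates (invariant_ring (@USp F m)) (USp_generators F m).
Proof.
move=> f; split=> [inv|[P <-] A USpA].
  have [|P ->] := generation p_pr r_gt0 cardF (f := f).
    move=> a b c ha hb _ ab _; rewrite -mpoly_actE; apply: inv; apply: rootelt_USp.
    by rewrite /=; lia.
  by exists P; rewrite comp_USp_generators.
rewrite comp_USp_generators mpoly_actE /matsub /evg subst_comp; apply: eq_subst => i.
exact: USp_generators_inv.
Qed.

Definition relations := [seq relation F 0 i | i <- xindices m].

(** The normal form of an element of the kernel is again in the kernel, hence zero by
    [independence]. *)
Lemma kernel_relations (P : T) : P \mPo USp_generators F m = 0 <-> in_ideal relations P.
Proof.
rewrite comp_USp_generators; split=> [P0|]; last exact: (evg_ideal p_pr cardF).
have [B PB bB] := normal_form p_pr cardF 0 P.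
suff B0 : B = 0 by rewrite B0 subr0 in PB.
apply: (independence p_pr r_gt0 cardF (leq0n m) bB).
have /eqP := evg_ideal p_pr cardF PB.
by rewrite (rmorphB (evg 0)) /= P0 sub0r oppr_eq0 => /eqP.
Qed.

Lemma relations_mord (P : T) : in_ideal relations P -> mord 2 P.
Proof.
move: P; apply: in_ideal_ind; [exact: mord0|exact: mordD|].
move=> P x /mapP [i /mapP [j _ ->] ->]; apply: mordMr.
by apply: (@relation_mord _ _ _ _ p_pr cardF 0 j); have := ltn_ord j; lia.
Qed.

(** An omitted generator would be a polynomial in the others, giving a relation with a linear term,
    against [relations_mord]. *)
Lemma generators_minimal (t : nat) (g : t.-tuple S) :
  subseq g (USp_generators F m) -> (t < s)%N ->
  ~ generates (invariant_ring (@USp F m)) g.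
Proof.
move=> /subseqP [b sz_b gE] ts gen.
pose L := mask b (enum 'I_s).
have gL : tval g = map (tnth (USp_generators F m)) L.
  by rewrite gE map_mask map_tnth_enum.
have szL : size L = t by rewrite -(size_map (tnth (USp_generators F m))) -gL size_tuple.
have [i iL] : exists i, i \notin L.
  apply/existsP; rewrite -negb_forall; apply/negP => /forallP allL.
  have : (#|'I_s| <= size L)%N.
    by apply: leq_trans (card_size L); apply/subset_leq_card/subsetP => i _; apply: allL.
  by rewrite card_ord szL leqNgt ts.
have [|P PE] := (gen (tnth (USp_generators F m) i)).1.
  apply/invariants_generated; exists 'X_i.
  by rewrite comp_mpolyXU -tnth_nth.
pose v (j : 'I_t) : 'I_s := tnth (in_tuple L) (cast_ord (esym szL) j).
pose Q : T := subst (fun j => 'X_(v j)) P.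
have QE : Q \mPo USp_generators F m = tnth (USp_generators F m) i.
  rewrite -PE !comp_mpoly_subst /Q subst_comp; apply: eq_subst => j; rewrite substX.
  rewrite [RHS](tnth_nth 0) gL (nth_map i) ?szL ?ltn_ord //.
  by congr (tnth _ _); rewrite /v (tnth_nth i).
have vi j : v j != i by apply: contraNneq iL => <-; apply: mem_tnth.
(* The linear coefficient is the constant term of the derivative along ['X_i], which vanishes as [Q]
   is built from other variables. *)
have Q0 : Q@_U_(i) = 0.
  have := mcoeff_deriv i 0%MM Q; rewrite add0m mnm0E mulr1n => <-.
  rewrite /Q chain_rule big1 ?mcoeff0 // => j _.
  by rewrite mderivX mnm1E (negPf (vi j)) scale0r mulr0.
have XQ : in_ideal relations ('X_i - Q).
  by apply/kernel_relations; rewrite comp_mpolyB QE comp_mpolyXU -tnth_nth subrr.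
have : U_(i)%MM \in msupp ('X_i - Q : T).
  by rewrite mcoeff_msupp mcoeffB mcoeffX eqxx Q0 subr0 oner_eq0.
by move/(relations_mord XQ); rewrite mdeg1.
Qed.

End FinalStep.

Theorem theorem5p7 (p r m : nat) (F : finFieldType)
    (p_prime : prime p) (r_gt0 : (0 < r)%N) (cardF : #|F| = (p ^ r)%N)
    (m_gt0 : (1 <= m)%N) :
  complete_intersection_generated_by
    (invariant_ring (@USp F m)) (USp_generators F m).
Proof.
split; last first.
  exists (relations F m); split; last exact: kernel_relations p_prime r_gt0 cardF.
  apply: (@triangular_regular _ _ (relwt F 0) (reldeg F 0)).
  - exact: reldeg_gt0.
  - exact: (@relation_leads _ _ _ _ p_prime cardF 0).
  exact: xindices_uniq.
split.
- by move=> i; rewrite (USp_generatorsE p_prime cardF); apply: gens_homog.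
- exact: invariants_generated p_prime r_gt0 cardF.
by move=> t g; apply: generators_minimal p_prime r_gt0 cardF t g.
Qed.
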